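(* Let $$G_1=\langle a,b,c \mid a^{11}=b^{11}=c^5=1,\ ab=ba,\ c^{-1}ac=a^3,\ c^{-1}bc=b^9\rangle,$$ $$G_2=\langle a,b,c \mid a^{11}=b^{11}=c^5=1,\ ab=ba,\ c^{-1}ac=a^3,\ c^{-1}bc=b^4\rangle.$$ Then $G_1$ and $G_2$ are nonisomorphic groups of order $605$ and, for every algebraically closed field $K$ of characteristic zero, the partial group algebras $K_{\mathrm{par}}(G_1)$ and $K_{\mathrm{par}}(G_2)$ are isomorphic as $K$-algebras.
   Context: For a finite group $G$ with identity $e$ and a field $K$, the partial group algebra $K_{\mathrm{par}}(G)$ is the universal associative $K$-algebra with unit $1$ generated by the set of symbols $\{[g] : g\in G\}$ subject to the relations (1) $[e]=1$; (2) $[s^{-1}][s][t]=[s^{-1}][st]$; (3) $[s][t][t^{-1}]=[st][t^{-1}]$, for all $s,t\in G$. *)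

(* Defs.v *)
From HB Require Import structures.
From mathcomp Require Import finmap monalg.
From mathcomp Require Import all_boot all_order all_algebra.
From mathcomp Require Import boolp.

Set Implicit Arguments.
Unset Strict Implicit.
Unset Printing Implicit Defensive.

Import GRing.Theory.

Local Open Scope quotient_scope.

(******************************************************************************)
(* Groups given by generators and relations, without any finiteness           *)
(* assumption. In a word, the letter (i, false) stands for the generator i    *)
(* and (i, true) for its inverse; a pair (u, v) in R is the relation u = v.   *)
(* pres_group R is the quotient of the words by the smallest congruence that  *)
(* cancels i i^-1 and i^-1 i and contains R; pres_groupP below is its         *)
(* universal property, among all groups.                                      *)
(******************************************************************************)

Notation word I := (seq (I * bool)).
Definition wgen I (i : I) : word I := [:: (i, false)].
Definition winv I (w : word I) : word I := rev [seq (x.1, ~~ x.2) | x <- w].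
Definition wexp I (w : word I) (n : nat) : word I := flatten (nseq n w).

Inductive weqv (I : choiceType) (R : seq (word I * word I)) :
    word I -> word I -> Prop :=
  | weqv_refl u : weqv R u u
  | weqv_sym u v : weqv R u v -> weqv R v u
  | weqv_trans u v w : weqv R u v -> weqv R v w -> weqv R u w
  | weqv_cat u u' v v' :
      weqv R u u' -> weqv R v v' -> weqv R (u ++ v) (u' ++ v')
  | weqv_cancel i b : weqv R [:: (i, b); (i, ~~ b)] [::]
  | weqv_rel u v : (u, v) \in R -> weqv R u v.

Section PresentedGroup.
Variables (I : choiceType) (R : seq (word I * word I)).
Implicit Types u v w : word I.

Definition weqvb : rel (word I) := fun u v => `[< weqv R u v >].

Lemma weqvb_refl : reflexive weqvb.
Proof. by move=> u; apply/asboolP; exact: weqv_refl. Qed.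

Lemma weqvb_sym : symmetric weqvb.
Proof. by move=> u v; apply/asboolP/asboolP; exact: weqv_sym. Qed.

Lemma weqvb_trans : transitive weqvb.
Proof.
by move=> v u w /asboolP uv /asboolP vw; apply/asboolP; exact: weqv_trans vw.
Qed.

Canonical weqv_equiv := EquivRel weqvb weqvb_refl weqvb_sym weqvb_trans.

Definition pres_group := {eq_quot weqv_equiv}.

HB.instance Definition _ := Choice.on pres_group.
HB.instance Definition _ : EqQuotient _ weqvb pres_group :=
  EqQuotient.on pres_group.

Definition pres_pi (w : word I) : pres_group := \pi_pres_group w.
Definition pres_gen (i : I) : pres_group := pres_pi (wgen i).

Lemma pres_piP u v : pres_pi u = pres_pi v <-> weqv R u v.
Proof.
split; first by move/eqP; rewrite /pres_pi eqmodE => /asboolP.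
by move=> uv; apply/eqP; rewrite /pres_pi eqmodE; apply/asboolP.
Qed.

Lemma pres_reprK (x : pres_group) : pres_pi (repr x) = x.
Proof. exact: reprK. Qed.

Lemma pres_repr_pi w : weqv R (repr (pres_pi w)) w.
Proof. by apply/pres_piP; rewrite pres_reprK. Qed.

Lemma winvK : involutive (@winv I).
Proof.
move=> w; rewrite /winv map_rev revK -map_comp -[RHS]map_id.
by apply: eq_map => -[i b] /=; rewrite negbK.
Qed.

Lemma winv_cat u v : winv (u ++ v) = winv v ++ winv u.
Proof. by rewrite /winv map_cat rev_cat. Qed.

Lemma weqv_winvr w : weqv R (w ++ winv w) [::].
Proof.
elim: w => [|[i b] w IHw]; first exact: weqv_refl.
rewrite -cat1s winv_cat -catA (catA w).
apply: weqv_trans (weqv_cancel R i b).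
rewrite -[X in weqv _ _ X]cat1s; apply: weqv_cat; first exact: weqv_refl.
rewrite -[X in weqv _ _ X]cat0s; apply: weqv_cat => //; exact: weqv_refl.
Qed.

Lemma weqv_winvl w : weqv R (winv w ++ w) [::].
Proof. by rewrite -{2}[w]winvK; exact: weqv_winvr. Qed.

Lemma weqv_winv u v : weqv R u v -> weqv R (winv u) (winv v).
Proof.
move=> uv; have rf := weqv_refl R.
apply: (@weqv_trans _ _ _ (winv u ++ (v ++ winv v))).
  rewrite -{1}[winv u]cats0; apply: weqv_cat => //.
  exact/weqv_sym/weqv_winvr.
rewrite catA -{2}[winv v]cat0s; apply: weqv_cat => //.
apply: weqv_trans (weqv_winvl u).
by apply: weqv_cat => //; exact: weqv_sym.
Qed.

Definition pres_one : pres_group := pres_pi [::].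
Definition pres_mul (x y : pres_group) : pres_group :=
  pres_pi (repr x ++ repr y).
Definition pres_inv (x : pres_group) : pres_group := pres_pi (winv (repr x)).

Lemma pres_mul_pi u v : pres_mul (pres_pi u) (pres_pi v) = pres_pi (u ++ v).
Proof. by apply/pres_piP; apply: weqv_cat; exact: pres_repr_pi. Qed.

Lemma pres_inv_pi u : pres_inv (pres_pi u) = pres_pi (winv u).
Proof. by apply/pres_piP; apply: weqv_winv; exact: pres_repr_pi. Qed.

Lemma pres_mulA : associative pres_mul.
Proof.
move=> x y z; rewrite -[x]pres_reprK -[y]pres_reprK -[z]pres_reprK.
by rewrite !pres_mul_pi catA.
Qed.

Lemma pres_mul1 : left_id pres_one pres_mul.
Proof. by move=> x; rewrite -[x]pres_reprK pres_mul_pi. Qed.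

Lemma pres_mulr1 : right_id pres_one pres_mul.
Proof. by move=> x; rewrite -[x]pres_reprK pres_mul_pi cats0. Qed.

Lemma pres_mulV : left_inverse pres_one pres_inv pres_mul.
Proof.
move=> x; rewrite -[x]pres_reprK pres_inv_pi pres_mul_pi.
by apply/pres_piP; exact: weqv_winvl.
Qed.

Lemma pres_mulrV : right_inverse pres_one pres_inv pres_mul.
Proof.
move=> x; rewrite -[x]pres_reprK pres_inv_pi pres_mul_pi.
by apply/pres_piP; exact: weqv_winvr.
Qed.

HB.instance Definition _ := isGroup.Build pres_group
  pres_mulA pres_mul1 pres_mulr1 pres_mulV pres_mulrV.

Definition weval (H : groupType) (h : I -> H) (w : word I) : H :=
  (\prod_(x <- w) if x.2 then (h x.1)^-1 else h x.1)%g.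

Lemma pres_groupP (H : groupType) (h : I -> H) :
    (forall u v, (u, v) \in R -> weval h u = weval h v) ->
  exists f : {multiplicative pres_group -> H},
    (forall i, f (pres_gen i) = h i) /\
    (forall g : {multiplicative pres_group -> H},
      (forall i, g (pres_gen i) = h i) -> g =1 f).
Proof.
move=> hR; have eval_eqv u v : weqv R u v -> weval h u = weval h v.
  elim=> [//|//|u1 u2 u3 _ -> _ -> //|u1 u2 v1 v2 _ eu _ ev|i []|].
  - by move: eu ev; rewrite /weval !big_cat /= => -> ->.
  - by rewrite /weval !big_cons big_nil /= mulg1 mulVg.
  - by rewrite /weval !big_cons big_nil /= mulg1 mulgV.
  - exact: hR.
pose f0 (x : pres_group) := weval h (repr x).
have f0_pi u : f0 (pres_pi u) = weval h u by apply/eval_eqv/pres_repr_pi.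
have f0M : {morph f0 : x y / (x * y)%g}.
  move=> x y; rewrite -[x]pres_reprK -[y]pres_reprK.
  rewrite -[(_ * _)%g]/(pres_mul _ _) pres_mul_pi !f0_pi.
  by rewrite /weval big_cat.
pose m := isMultiplicative.Build pres_group H f0 f0M.
pose f : {multiplicative pres_group -> H} := HB.pack f0 m.
exists f; split=> [i|g gi x].
  by rewrite -[LHS]/(f0 _) f0_pi /weval big_seq1.
have g1 : g 1%g = 1%g.
  by apply: (mulgI (g 1%g)); rewrite -gmulfM !mulg1.
have gV y : g y^-1%g = (g y)^-1%g.
  by apply: (mulIg (g y)); rewrite -gmulfM !mulVg.
rewrite -[x]pres_reprK -[RHS]/(f0 _) f0_pi.
elim: (repr x) => [|[i b] w IHw]; first by rewrite /weval big_nil.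
have -> : pres_pi ((i, b) :: w) = (pres_pi [:: (i, b)] * pres_pi w)%g.
  by rewrite -[RHS]/(pres_mul _ _) pres_mul_pi.
rewrite gmulfM IHw /weval big_cons /=; congr (_ * _)%g.
case: b; last exact: gi.
by rewrite -gi -gV; congr (g _); rewrite -[RHS]/(pres_inv _) pres_inv_pi.
Qed.

End PresentedGroup.

(******************************************************************************)
(* The partial group algebra: the free K-algebra on the symbols [g], g in G   *)
(* (the monoid algebra of the free monoid on G), modulo the two-sided ideal   *)
(* generated by the three families of relations. KparP is the universal       *)
(* property; an algType is a nonzero unital algebra, which loses nothing      *)
(* since maps to the zero algebra exist and are unique.                       *)
(******************************************************************************)

Local Open Scope ring_scope.

Section FreeAlgebra.
Variables (K : fieldType) (M : monomType).

Lemma malg_scalerAr (c : K) (x y : {malg K[M]}) : c *: (x * y) = x * (c *: y).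
Proof.
rewrite malgME scaler_sumr [RHS](malgMEw (fsubset_refl _) (msuppZ_le _ _)).
apply: eq_bigr => k1 _; rewrite scaler_sumr; apply: eq_bigr => k2 _.
apply/malgP => k; rewrite !mcoeffZ !mcoeffU.
by rewrite mulrnAr mulrCA.
Qed.

End FreeAlgebra.

Section PartialGroupAlgebra.
Variables (K : fieldType) (G : groupType).

Notation free_alg := {malg K[{fmonom G}]}.

Definition fsym (g : G) : free_alg := << fmu g >>.

Inductive par_rel : free_alg -> free_alg -> Prop :=
  | par_rel_one : par_rel (fsym 1%g) 1
  | par_rel_left s t :
      par_rel (fsym s^-1%g * fsym s * fsym t) (fsym s^-1%g * fsym (s * t)%g)
  | par_rel_right s t :
      par_rel (fsym s * fsym t * fsym t^-1%g) (fsym (s * t)%g * fsym t^-1%g).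

Inductive par_ideal : free_alg -> Prop :=
  | par_ideal_rel x y : par_rel x y -> par_ideal (x - y)
  | par_ideal0 : par_ideal 0
  | par_idealD x y : par_ideal x -> par_ideal y -> par_ideal (x + y)
  | par_idealMl a x : par_ideal x -> par_ideal (a * x)
  | par_idealMr x a : par_ideal x -> par_ideal (x * a).

Lemma par_idealZ c x : par_ideal x -> par_ideal (c *: x).
Proof. by move=> Ix; rewrite -[x]mul1r scalerAl; exact: par_idealMl. Qed.

Lemma par_idealN x : par_ideal x -> par_ideal (- x).
Proof. by move=> Ix; rewrite -scaleN1r; exact: par_idealZ. Qed.

Section FreeEval.
Variables (A : algType K) (h : G -> A).

Definition fmon_eval (m : {fmonom G}) : A := \prod_(g <- (m : seq G)) h g.

Lemma fmon_eval_morph : mmorphism fmon_eval.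
Proof.
split=> [m1 m2|]; first by rewrite /fmon_eval fmM big_cat.
by rewrite /fmon_eval fm1 big_nil.
Qed.

HB.instance Definition _ :=
  monalg.isMultiplicative.Build {fmonom G} A fmon_eval fmon_eval_morph.

Definition free_eval : free_alg -> A := mmap (GRing.in_alg A) fmon_eval.

Lemma free_evalD x y : free_eval (x + y) = free_eval x + free_eval y.
Proof. exact: mmapD. Qed.

Lemma free_evalB x y : free_eval (x - y) = free_eval x - free_eval y.
Proof. exact: (raddfB (mmap (GRing.in_alg A) fmon_eval)). Qed.

Lemma free_evalM x y : free_eval (x * y) = free_eval x * free_eval y.
Proof.
apply: (commr_mmap_is_multiplicative _).1 => g m m'.
by rewrite /GRing.comm /= -scalerAl mul1r -scalerAr mulr1.
Qed.

Lemma free_eval1 : free_eval 1 = 1.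
Proof. exact: mmap1. Qed.

Lemma free_evalZ c x : free_eval (c *: x) = c *: free_eval x.
Proof. by rewrite /free_eval mmapZ /= -scalerAl mul1r. Qed.

Lemma free_eval_sym g : free_eval (fsym g) = h g.
Proof.
by rewrite /free_eval mmapU /= scale1r mul1r /fmon_eval fmU big_seq1.
Qed.

Hypothesis h1 : h 1%g = 1.
Hypothesis hl : forall s t, h s^-1%g * h s * h t = h s^-1%g * h (s * t)%g.
Hypothesis hr : forall s t, h s * h t * h t^-1%g = h (s * t)%g * h t^-1%g.

Lemma free_eval_ideal x : par_ideal x -> free_eval x = 0.
Proof.
elim=> [{}x y|| u v _ u0 _ v0|a u _ u0|u a _ u0].
- rewrite free_evalB => -[|s t|s t];
    rewrite ?free_evalM ?free_eval_sym ?free_eval1 ?h1 ?hl ?hr subrr //.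
- by rewrite -(scale0r 1) free_evalZ scale0r.
- by rewrite free_evalD u0 v0 addr0.
- by rewrite free_evalM u0 mulr0.
- by rewrite free_evalM u0 mul0r.
Qed.

End FreeEval.

Lemma par_ideal_proper : ~ par_ideal 1.
Proof.
have h1 : (fun=> 1 : K^o) (1%g : G) = 1 by [].
have hh (s t : G) : (1 : K^o) * 1 * 1 = 1 * 1 by rewrite !mulr1.
move=> /(@free_eval_ideal K^o (fun=> 1) h1 hh hh) /eqP.
by rewrite free_eval1 oner_eq0.
Qed.

Definition par_eqv : rel free_alg := fun x y => `[< par_ideal (x - y) >].

Lemma par_eqv_refl : reflexive par_eqv.
Proof. by move=> x; apply/asboolP; rewrite subrr; exact: par_ideal0. Qed.

Lemma par_eqv_sym : symmetric par_eqv.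
Proof.
by move=> x y; apply/asboolP/asboolP => /par_idealN; rewrite opprB.
Qed.

Lemma par_eqv_trans : transitive par_eqv.
Proof.
move=> y x z /asboolP xy /asboolP yz; apply/asboolP.
by rewrite -(subrKA y); exact: par_idealD.
Qed.

Canonical par_equiv := EquivRel par_eqv par_eqv_refl par_eqv_sym par_eqv_trans.

Definition Kpar := {eq_quot par_equiv}.

HB.instance Definition _ := Choice.on Kpar.
HB.instance Definition _ : EqQuotient _ par_eqv Kpar := EqQuotient.on Kpar.

Definition kpi (x : free_alg) : Kpar := \pi_Kpar x.

Lemma kpiP x y : kpi x = kpi y <-> par_ideal (x - y).
Proof.
split; first by move/eqP; rewrite /kpi eqmodE => /asboolP.
by move=> xy; apply/eqP; rewrite /kpi eqmodE; apply/asboolP.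
Qed.

Lemma kreprK (x : Kpar) : kpi (repr x) = x.
Proof. exact: reprK. Qed.

Lemma krepr_pi x : par_ideal (repr (kpi x) - x).
Proof. by apply/kpiP; rewrite kreprK. Qed.

Definition kadd (x y : Kpar) : Kpar := kpi (repr x + repr y).
Definition kopp (x : Kpar) : Kpar := kpi (- repr x).
Definition kmul (x y : Kpar) : Kpar := kpi (repr x * repr y).
Definition kscale (c : K) (x : Kpar) : Kpar := kpi (c *: repr x).

Lemma kadd_pi x y : kadd (kpi x) (kpi y) = kpi (x + y).
Proof.
apply/kpiP; rewrite opprD addrACA.
by apply: par_idealD; exact: krepr_pi.
Qed.

Lemma kopp_pi x : kopp (kpi x) = kpi (- x).
Proof. by apply/kpiP; rewrite -opprD; apply: par_idealN; exact: krepr_pi. Qed.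

Lemma kmul_pi x y : kmul (kpi x) (kpi y) = kpi (x * y).
Proof.
apply/kpiP; set x' := repr _; set y' := repr _.
have -> : x' * y' - x * y = (x' - x) * y' + x * (y' - y).
  by rewrite mulrBl mulrBr addrA subrK.
by apply: par_idealD; [apply: par_idealMr|apply: par_idealMl]; exact: krepr_pi.
Qed.

Lemma kscale_pi c x : kscale c (kpi x) = kpi (c *: x).
Proof. by apply/kpiP; rewrite -scalerBr; apply: par_idealZ; exact: krepr_pi. Qed.

Let kE := (kadd_pi, kopp_pi, kmul_pi, kscale_pi).

Lemma kaddA : associative kadd.
Proof.
by move=> x y z; rewrite -[x]kreprK -[y]kreprK -[z]kreprK !kE addrA.
Qed.

Lemma kaddC : commutative kadd.
Proof. by move=> x y; rewrite -[x]kreprK -[y]kreprK !kE addrC. Qed.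

Lemma kadd0 : left_id (kpi 0) kadd.
Proof. by move=> x; rewrite -[x]kreprK !kE add0r. Qed.

Lemma kaddN : left_inverse (kpi 0) kopp kadd.
Proof. by move=> x; rewrite -[x]kreprK !kE addNr. Qed.

HB.instance Definition _ :=
  GRing.isZmodule.Build Kpar kaddA kaddC kadd0 kaddN.

Lemma kmulA : associative kmul.
Proof.
by move=> x y z; rewrite -[x]kreprK -[y]kreprK -[z]kreprK !kE mulrA.
Qed.

Lemma kmul1 : left_id (kpi 1) kmul.
Proof. by move=> x; rewrite -[x]kreprK !kE mul1r. Qed.

Lemma kmulr1 : right_id (kpi 1) kmul.
Proof. by move=> x; rewrite -[x]kreprK !kE mulr1. Qed.

Lemma kmulDl : left_distributive kmul kadd.
Proof.
by move=> x y z; rewrite -[x]kreprK -[y]kreprK -[z]kreprK !kE mulrDl.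
Qed.

Lemma kmulDr : right_distributive kmul kadd.
Proof.
by move=> x y z; rewrite -[x]kreprK -[y]kreprK -[z]kreprK !kE mulrDr.
Qed.

Lemma k1_neq0 : kpi 1 != kpi 0.
Proof. by apply/eqP => /kpiP; rewrite subr0; exact: par_ideal_proper. Qed.

HB.instance Definition _ := GRing.Zmodule_isNzRing.Build Kpar
  kmulA kmul1 kmulr1 kmulDl kmulDr k1_neq0.

Lemma kscaleA a b x : kscale a (kscale b x) = kscale (a * b) x.
Proof. by rewrite -[x]kreprK !kE scalerA. Qed.

Lemma kscale1 : left_id 1 kscale.
Proof. by move=> x; rewrite -[x]kreprK !kE scale1r. Qed.

Lemma kscaleDr : right_distributive kscale +%R.
Proof.
move=> c x y; rewrite -[x]kreprK -[y]kreprK.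
by rewrite -![_ + _ in X in X = _]/(kadd _ _) -[RHS]/(kadd _ _) !kE scalerDr.
Qed.

Lemma kscaleDl x : {morph kscale^~ x : a b / a + b}.
Proof.
by move=> a b; rewrite -[x]kreprK -[RHS]/(kadd _ _) !kE scalerDl.
Qed.

HB.instance Definition _ := GRing.Zmodule_isLmodule.Build K Kpar
  kscaleA kscale1 kscaleDr kscaleDl.

Lemma kscaleAl (c : K) (x y : Kpar) : c *: (x * y) = c *: x * y.
Proof.
rewrite -[x]kreprK -[y]kreprK.
rewrite -[LHS]/(kscale c (kmul _ _)) -[RHS]/(kmul (kscale c _) _) !kE.
by rewrite scalerAl.
Qed.

HB.instance Definition _ := GRing.Lmodule_isLalgebra.Build K Kpar kscaleAl.

Lemma kscaleAr (c : K) (x y : Kpar) : c *: (x * y) = x * (c *: y).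
Proof.
rewrite -[x]kreprK -[y]kreprK.
rewrite -[LHS]/(kscale c (kmul _ _)) -[RHS]/(kmul _ (kscale c _)) !kE.
by rewrite malg_scalerAr.
Qed.

HB.instance Definition _ := GRing.Lalgebra_isAlgebra.Build K Kpar kscaleAr.

Definition ksym (g : G) : Kpar := kpi (fsym g).

Lemma kpiM x y : kpi (x * y) = kpi x * kpi y.
Proof. by rewrite -kmul_pi. Qed.

Lemma ksym1 : ksym 1%g = 1.
Proof. by apply/kpiP; apply: par_ideal_rel; exact: par_rel_one. Qed.

Lemma ksym_left s t :
  ksym s^-1%g * ksym s * ksym t = ksym s^-1%g * ksym (s * t)%g.
Proof.
rewrite -(kpiM (fsym s^-1%g) (fsym s)) -!kpiM.
by apply/kpiP; apply: par_ideal_rel; exact: par_rel_left.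
Qed.

Lemma ksym_right s t :
  ksym s * ksym t * ksym t^-1%g = ksym (s * t)%g * ksym t^-1%g.
Proof.
rewrite -(kpiM (fsym s) (fsym t)) -!kpiM.
by apply/kpiP; apply: par_ideal_rel; exact: par_rel_right.
Qed.

Lemma KparP (A : algType K) (h : G -> A) :
    h 1%g = 1 ->
    (forall s t, h s^-1%g * h s * h t = h s^-1%g * h (s * t)%g) ->
    (forall s t, h s * h t * h t^-1%g = h (s * t)%g * h t^-1%g) ->
  exists f : {lrmorphism Kpar -> A},
    (forall g, f (ksym g) = h g) /\
    (forall f' : {lrmorphism Kpar -> A},
      (forall g, f' (ksym g) = h g) -> f' =1 f).
Proof.
move=> h1 hl hr; pose f0 (x : Kpar) : A := free_eval h (repr x).
have f0_pi x : f0 (kpi x) = free_eval h x.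
  apply/eqP; rewrite -subr_eq0 -free_evalB; apply/eqP.
  by apply: free_eval_ideal => //; exact: krepr_pi.
have f0B : {morph f0 : x y / x - y}.
  move=> x y; rewrite -[x]kreprK -[y]kreprK.
  by rewrite -[_ - _ in LHS]/(kadd _ (kopp _)) !kE !f0_pi free_evalB.
have f0Z : scalable_for *:%R f0.
  move=> c x; rewrite -[x]kreprK.
  by rewrite -[_ *: _ in LHS]/(kscale _ _) !kE !f0_pi free_evalZ.
have f0M : monoid_morphism f0.
  split=> [|x y]; first by rewrite -[1]/(kpi 1) f0_pi free_eval1.
  rewrite -[x]kreprK -[y]kreprK.
  by rewrite -[_ * _ in LHS]/(kmul _ _) !kE !f0_pi free_evalM.
pose mB := GRing.isZmodMorphism.Build _ _ f0 f0B.
pose mZ := GRing.isScalable.Build K Kpar A *:%R f0 f0Z.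
pose mM := GRing.isMonoidMorphism.Build _ _ f0 f0M.
pose f : {lrmorphism Kpar -> A} := HB.pack f0 mB mZ mM.
exists f; split=> [g|f' f'h x].
  by rewrite -[LHS]/(f0 _) f0_pi free_eval_sym.
rewrite -[x]kreprK -[RHS]/(f0 _) f0_pi.
have kpiD u v : kpi (u + v) = kpi u + kpi v by rewrite -kadd_pi.
have kpiZ c u : kpi (c *: u) = c *: kpi u by rewrite -kscale_pi.
have f'mon (s : seq G) : f' (kpi << FMonom s >>) = free_eval h << FMonom s >>.
  elim: s => [|g s IHs].
    have -> : << FMonom [::] >> = 1 :> free_alg.
      by rewrite -fmoneE.
    by rewrite -[kpi 1]/(1 : Kpar) rmorph1 free_eval1.
  have -> : << FMonom (g :: s) >> = fsym g * << FMonom s >> :> free_alg.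
    by rewrite malgM_def fgmulUU mulr1 -[mmul _ _]/(fmmul _ _) fmmulE fmuE.
  by rewrite kpiM rmorphM /= -/(ksym g) f'h IHs free_evalM free_eval_sym.
rewrite [repr x]monalgE.
elim/big_rec: _ => [|m u _ IHu].
  by rewrite -[kpi 0]/(0 : Kpar) raddf0 /free_eval raddf0.
rewrite kpiD raddfD /= free_evalD IHu; congr (_ + _).
have -> : << (repr x)@_m *g m >> = (repr x)@_m *: << m >> :> free_alg.
  by rewrite -mul_malgC malgM_def fgmulUU mulr1 mul1m.
by rewrite kpiZ linearZ /= free_evalZ -[m]fmK f'mon.
Qed.

End PartialGroupAlgebra.

(* The generators a, b, c are the elements 0, 1, 2 of 'I_3. *)
Definition rels605 (k : nat) : seq (word 'I_3 * word 'I_3) :=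
  let a := wgen (inord 0) in let b := wgen (inord 1) in
  let c := wgen (inord 2) in
  [:: (wexp a 11, [::]); (wexp b 11, [::]); (wexp c 5, [::]);
      (a ++ b, b ++ a);
      (winv c ++ a ++ c, wexp a 3); (winv c ++ b ++ c, wexp b k)].

Definition G1 : groupType := pres_group (rels605 9).
Definition G2 : groupType := pres_group (rels605 4).

(* Main.v *)
From HB Require Import structures.
Require Import Defs.
From mathcomp Require Import all_boot all_order all_algebra.
From mathcomp Require Import all_fingroup all_solvable finfield ring.

Set Implicit Arguments.
Unset Strict Implicit.
Unset Printing Implicit Defensive.

Import GRing.Theory.

(**
For a finite group G, the partial group algebra of G is the algebra of a finite
groupoid. Its objects are the subsets A of G that contain 1, and each g in A
gives an arrow from A to A g^-1. Indeed the elements [r^-1][r] are commuting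
idempotents, so their products cut 1 into orthogonal idempotents indexed by the
subsets of G, and [g] moves the idempotent of A to that of A g^-1 or kills it.
The lemmas par_arrow_family and Kpar_arrow_lift present the algebra by the arrows
and the relations between them, so isomorphisms are built and inverted on arrows.

The full subset G is an object isolated from all others, with endomorphism
group G, and contributes the group algebra KG. It is treated apart from the
remaining objects; Kpar_iso glues an isomorphism between the two group algebras
to an isomorphism between the groupoids of the remaining objects.

The groupoid of the proper subsets. Two objects are connected when they are
right translates of each other. The component of S has the stabilizer H of S
under right translation as vertex group and |S| / |H| objects, so it is
determined up to isomorphism by |S| and H (equivariant_bijection,
exists_vertex_functor). In each of the two groups a proper subgroup is
determined up to isomorphism by its order, even across the groups
(isog_proper_subgroups), so one only has to see that both groups have equally
many subsets of each size whose stabilizer has a given order. The number of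
subsets of size k fixed by a subgroup H depends only on |H| and k, so this
follows by induction on the subgroups, from the top, once the subgroup lattices
are isomorphic with preservation of orders (nb_stab_lattice). The isomorphism of
lattices comes from a bijection theta between the two groups that maps subgroups
to subgroups.

The group algebras. By Fourier transform on the normal subgroup F_11^2, KG is
the algebra of the action groupoid of the cyclic group of order 5 on the dual of
F_11^2, on which a generator acts by diag(3, 9) for the first group and by
diag(3, 4) for the second. As 9^7 = 4 modulo 11 and 7 is prime to 10, the map
(x, y) |-> (x, y^7) is an equivariant bijection between these two actions
(psi_pow_twist, fourier_mx_multiplicative). The Fourier transform uses a
primitive 11th root of unity and the invertibility of 11 in K.

Both groups are identified with explicit semidirect products, which gives their
order. They are not isomorphic because an isomorphism would send the generator c
to an element acting on F_11^2 with eigenvalues 3 and 9, and no power of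
diag(3, 4) has these two eigenvalues.
*)

Local Open Scope ring_scope.

(** * Partial representations and the arrows of their groupoid *)

Section Multiplicative.
Variables (G H : groupType) (f : {multiplicative G -> H}).

Lemma multiplicative1 : f 1%g = 1%g.
Proof. by apply: (mulgI (f 1%g)); rewrite -gmulfM !mulg1. Qed.

Lemma multiplicativeX x n : f (x ^+ n)%g = (f x ^+ n)%g.
Proof. by elim: n => [|n IHn]; rewrite ?multiplicative1 // !expgS gmulfM IHn. Qed.

Lemma multiplicativeV x : f x^-1%g = (f x)^-1%g.
Proof. by apply: (mulIg (f x)); rewrite -gmulfM !mulVg multiplicative1. Qed.

Lemma multiplicativeJ x y : f (x ^ y)%g = (f x ^ f y)%g.
Proof. by rewrite !conjgE !gmulfM multiplicativeV. Qed.

Lemma multiplicative_inverse : bijective f ->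
  exists g : {multiplicative H -> G}, cancel f g /\ cancel g f.
Proof.
case=> g fK gK.
pose gm := isMultiplicative.Build H G g (can2_gmulfM fK gK).
by exists (HB.pack g gm : {multiplicative H -> G}).
Qed.

End Multiplicative.

(** The relations of the partial group algebra, in an arbitrary ring: all
computations below take place in an abstract ring rather than in the quotient
that defines the partial group algebra. *)
Record partial_rep (G : groupType) (A : nzRingType) (p : G -> A) : Prop :=
  PartialRep {
    prep1 : p 1%g = 1;
    prep_left s t : p s^-1%g * p s * p t = p s^-1%g * p (s * t)%g;
    prep_right s t : p s * p t * p t^-1%g = p (s * t)%g * p t^-1%g
  }.

Lemma Kpar_ext (K : fieldType) (G : groupType) (A : algType K)
    (f f' : {lrmorphism Kpar K G -> A}) :
  (forall g, f (ksym K g) = f' (ksym K g)) -> f =1 f'.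
Proof.
move=> ff'; pose h g := f' (ksym K g).
have h1 : h 1%g = 1 by rewrite /h ksym1 rmorph1.
have hl s t : h s^-1%g * h s * h t = h s^-1%g * h (s * t)%g.
  by rewrite /h -!rmorphM ksym_left.
have hr s t : h s * h t * h t^-1%g = h (s * t)%g * h t^-1%g.
  by rewrite /h -!rmorphM ksym_right.
have [f0 [_ f0u] x] := KparP h1 hl hr.
by rewrite f0u // (f0u f').
Qed.

Lemma Kpar_transport (K : fieldType) (G H : groupType)
    (f : {multiplicative G -> H}) : bijective f ->
  exists F : {lrmorphism Kpar K G -> Kpar K H}, bijective F.
Proof.
move=> /multiplicative_inverse[g [fK gK]].
have lift (G1 G2 : groupType) (h : {multiplicative G1 -> G2}) :
    exists F : {lrmorphism Kpar K G1 -> Kpar K G2},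
      forall x, F (ksym K x) = ksym K (h x).
  have e1 : ksym K (h 1%g) = 1 by rewrite multiplicative1 ksym1.
  have e2 s t : ksym K (h s^-1%g) * ksym K (h s) * ksym K (h t)
             = ksym K (h s^-1%g) * ksym K (h (s * t)%g).
    by rewrite multiplicativeV gmulfM; exact: ksym_left.
  have e3 s t : ksym K (h s) * ksym K (h t) * ksym K (h t^-1%g)
             = ksym K (h (s * t)%g) * ksym K (h t^-1%g).
    by rewrite multiplicativeV gmulfM; exact: ksym_right.
  by have [F [FE _]] := KparP (h := fun x => ksym K (h x)) e1 e2 e3; exists F.
have [F FE] := lift _ _ f; have [F' F'E] := lift _ _ g.
exists F; exists F'.
  by apply: (Kpar_ext (f := F' \o F) (f' := idfun)) => x /=; rewrite FE F'E fK.
by apply: (Kpar_ext (f := F \o F') (f' := idfun)) => x /=; rewrite F'E FE gK.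
Qed.

Section FinitePar.
Variables (gT : finGroupType) (R : nzRingType) (p : gT -> R).
Hypothesis p_rep : partial_rep p.
Implicit Types (g h r s : gT) (A B : {set gT}).

(** If a partial representation is thought of as a partial action, p g is a
partial map, and this idempotent projects onto the points where it is defined. *)
Definition par_dom r : R := p r^-1%g * p r.

Lemma prepVK g : p g * p g^-1%g * p g = p g.
Proof.
by have := prep_right p_rep g g^-1%g; rewrite invgK mulgV (prep1 p_rep) mul1r.
Qed.

Lemma prep_dom g r : p g * par_dom r = par_dom (r * g^-1)%g * p g.
Proof.
rewrite /par_dom mulrA.
have := prep_right p_rep g r^-1%g; rewrite invgK => ->.
by rewrite (prep_left p_rep) invgM invgK mulgKV.
Qed.

Lemma prepM_dom g h : p g * p h * par_dom h = p (g * h)%g * par_dom h.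
Proof.
by rewrite /par_dom mulrA (prep_right p_rep) -mulrA.
Qed.

Lemma par_domC r s : par_dom r * par_dom s = par_dom s * par_dom r.
Proof.
rewrite {1}/par_dom -mulrA prep_dom mulrA prep_dom invgK mulgKV.
by rewrite -mulrA.
Qed.

Lemma par_domK r : par_dom r * par_dom r = par_dom r.
Proof. by rewrite /par_dom mulrA -(mulrA _ (p r)) -mulrA prepVK. Qed.

Lemma par_dom1 : par_dom 1%g = 1.
Proof. by rewrite /par_dom invg1 (prep1 p_rep) mulr1. Qed.

Definition par_coord A r : R :=
  if r \in A then par_dom r else 1 - par_dom r.

(** The part of 1 where exactly the elements of A act. The factors commute, but
the ring does not, so the product follows the enumeration of the group. *)
Definition par_vertex A : R := \prod_r par_coord A r.

Lemma par_coord_dom A r s : GRing.comm (par_dom s) (par_coord A r).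
Proof.
rewrite /par_coord; case: ifP => _; first exact: par_domC.
by apply: commrB; [exact: commr1 | exact: par_domC].
Qed.

Lemma par_coordK A r : par_dom r * par_coord A r = (r \in A)%:R * par_coord A r.
Proof.
rewrite /par_coord; case: ifP => _; first by rewrite mul1r par_domK.
by rewrite mulrBr mulr1 par_domK subrr mul0r.
Qed.

Lemma dom_vertex A r : par_dom r * par_vertex A = (r \in A)%:R * par_vertex A.
Proof.
rewrite /par_vertex; have : r \in index_enum gT by rewrite mem_index_enum.
elim: (index_enum gT) => // s l IHl; rewrite inE big_cons.
have [<- _|_ /= rl] := eqVneq r s; first by rewrite mulrA par_coordK -mulrA.
by rewrite mulrA par_coord_dom -mulrA IHl // mulr_natl mulrnAr -mulr_natl.
Qed.

Lemma vertex_dom A r : par_vertex A * par_dom r = (r \in A)%:R * par_vertex A.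
Proof.
rewrite -dom_vertex; apply/esym/commr_prod => s _; exact: par_coord_dom.
Qed.

Lemma sum_vertex : \sum_A par_vertex A = 1.
Proof.
rewrite /par_vertex /par_coord.
rewrite -(bigA_distr _ _ par_dom (fun r => 1 - par_dom r)).
by rewrite big1 // => r _ /=; rewrite addrC subrK.
Qed.

(** An element r acts at x if and only if r g^-1 acts at g x. So when B is not
A g^-1, some r separates them, and the idempotent of r, moved across p g,
is 1 on one side and 0 on the other. *)
Lemma vertex_arrow0 A B g :
  B != (A :* g^-1)%g -> par_vertex B * p g * par_vertex A = 0.
Proof.
move=> BA.
have [r rBA] : exists r, (r * g^-1 \in B)%g != (r \in A).
  apply/existsP; apply: contraR BA => /existsPn eqBA; apply/eqP/setP=> r.
  by have:= eqBA (r * g)%g; rewrite negbK mulgK => /eqP->; rewrite mem_rcoset invgK.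
have : par_vertex B * (p g * par_dom r) * par_vertex A =
       par_vertex B * (par_dom (r * g^-1)%g * p g) * par_vertex A.
  by rewrite prep_dom.
rewrite (mulrA _ (par_dom _)) vertex_dom (mulrA _ (p g)) -(mulrA _ _ (par_vertex A)).
rewrite dom_vertex.
by case: (_ \in B) (_ \in A) rBA => -[] //= _; rewrite !(mul0r, mulr0, mul1r).
Qed.

(** Reindexing the product that defines the vertex would permute its factors.
Instead both sides are expanded with the decomposition of 1 into vertices, and
only the term p g between A and A g^-1 survives. *)
Lemma prep_vertex g A : p g * par_vertex A = par_vertex (A :* g^-1)%g * p g.
Proof.
rewrite -[LHS]mul1r -sum_vertex mulr_suml.
rewrite (bigD1 (A :* g^-1)%g) //= big1 ?addr0 => [|B nB]; last first.
  by rewrite mulrA vertex_arrow0.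
rewrite -[RHS]mulr1 -sum_vertex mulr_sumr.
rewrite (bigD1 A) //= big1 ?addr0 ?mulrA // => B nB.
by rewrite vertex_arrow0 // (inj_eq (@rcoset_inj _ _)) eq_sym.
Qed.

Lemma vertexM A B : par_vertex A * par_vertex B = if A == B then par_vertex B else 0.
Proof.
have orth C D : C != D -> par_vertex C * par_vertex D = 0.
  move=> nCD; rewrite -[par_vertex C]mulr1 -(prep1 p_rep) vertex_arrow0 //.
  by rewrite invg1 rcoset1.
have [->|/orth//] := eqVneq A B.
rewrite -[RHS]mul1r -sum_vertex mulr_suml.
by rewrite (bigD1 B) //= big1 ?addr0 // => C /orth.
Qed.

(** The arrow g from the vertex A to the vertex A g^-1; it vanishes unless A
contains both 1 and g. *)
Definition par_arrow A g : R := p g * par_vertex A.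

Lemma prep_sum_arrow g : p g = \sum_A par_arrow A g.
Proof. by rewrite -mulr_sumr sum_vertex mulr1. Qed.

Lemma par_arrow1 A : par_arrow A 1%g = par_vertex A.
Proof. by rewrite /par_arrow (prep1 p_rep) mul1r. Qed.

Lemma par_arrow0 A g : ~~ ((1%g \in A) && (g \in A)) -> par_arrow A g = 0.
Proof.
rewrite negb_and /par_arrow => /orP[] /negPf Ag.
  by rewrite -[par_vertex A]mul1r -par_dom1 dom_vertex Ag mul0r mulr0.
by rewrite -prepVK -(mulrA (p g)) -mulrA dom_vertex Ag mul0r mulr0.
Qed.

Lemma par_arrowM A B g h : h \in B ->
  par_arrow A g * par_arrow B h =
  if A == (B :* h^-1)%g then par_arrow B (g * h)%g else 0.
Proof.
move=> hB; rewrite /par_arrow mulrA -(mulrA (p g)) -[A in LHS](rcosetK h).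
rewrite -prep_vertex -!mulrA vertexM -[A == _](inj_eq (@rcoset_inj _ h)) rcosetKV.
case: eqP => _; last by rewrite !mulr0.
have eB : par_vertex B = par_dom h * par_vertex B by rewrite dom_vertex hB mul1r.
by rewrite eB mulrA (mulrA _ (par_dom h)) prepM_dom -(mulrA _ (par_dom h)).
Qed.

End FinitePar.

Section ArrowFamily.
Variables (gT : finGroupType) (R : nzRingType).
Implicit Types (g h r s : gT) (A B : {set gT}).

(** A representation of the groupoid of subsets of G containing 1: v A g is the
image of the arrow g out of A, extended by 0 to pairs that are not arrows, and
products of non-composable arrows are 0. *)
Record arrow_family (v : {set gT} -> gT -> R) : Prop := ArrowFamily {
  arrow0 A g : ~~ ((1%g \in A) && (g \in A)) -> v A g = 0;
  arrowM A B g h : 1%g \in B -> h \in B ->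
    v A g * v B h = if A == (B :* h^-1)%g then v B (g * h)%g else 0;
  arrow_sum : \sum_A v A 1%g = 1
}.

Lemma par_arrow_family (p : gT -> R) : partial_rep p -> arrow_family (par_arrow p).
Proof.
move=> p_rep; split=> [A g|A B g h _|]; first exact: par_arrow0.
  exact: par_arrowM.
by under eq_bigr do rewrite par_arrow1 //; exact: sum_vertex.
Qed.

Variable v : {set gT} -> gT -> R.
Hypothesis v_fam : arrow_family v.

Definition arrow_rep g : R := \sum_A v A g.

Lemma arrow_repM g B h :
  arrow_rep g * v B h = if h \in B then v B (g * h)%g else 0.
Proof.
rewrite mulr_suml; case: ifPn => hB; last first.
  by rewrite big1 // => A _; rewrite (arrow0 v_fam (g := h)) ?mulr0 // (negPf hB) andbF.
have [B1|nB1] := boolP (1%g \in B); last first.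
  rewrite big1 => [|A _]; first by rewrite (arrow0 v_fam) ?(negPf nB1).
  by rewrite (arrow0 v_fam (g := h)) ?mulr0 // (negPf nB1).
rewrite (bigD1 (B :* h^-1)%g) //= arrowM // eqxx big1 ?addr0 // => A nA.
by rewrite arrowM // (negPf nA).
Qed.

(** Multiplying by p h selects the subsets that contain h. Both sides of each
relation select the same subsets. *)
Lemma arrow_rep_partial : partial_rep arrow_rep.
Proof.
have double g h t : arrow_rep g * arrow_rep h * arrow_rep t =
    \sum_(B : {set gT}) if (t \in B) && (h * t \in B)%g then v B (g * (h * t))%g else 0.
  rewrite -mulrA 2!mulr_sumr; apply: eq_bigr => B _.
  rewrite arrow_repM; case: ifP => //= _; last by rewrite mulr0.
  by rewrite arrow_repM.
have single g h : arrow_rep g * arrow_rep h =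
    \sum_(B : {set gT}) if h \in B then v B (g * h)%g else 0.
  by rewrite mulr_sumr; apply: eq_bigr => B _; rewrite arrow_repM.
split; first exact: (arrow_sum v_fam).
  move=> s t; rewrite double single; apply: eq_bigr => B _.
  rewrite mulKg; case: ifP => [/andP[_ ->] //|]; case: ifP => // stB /negbT.
  rewrite andbT => ntB; rewrite (arrow0 v_fam) //.
  by rewrite (negPf ntB) andbF.
move=> s t; rewrite double single; apply: eq_bigr => B _.
rewrite mulgV -mulgA mulgV; case: (t^-1 \in B)%g => //=.
by case: ifPn => // nB; rewrite (arrow0 v_fam) // (negPf nB).
Qed.

(** The passages from partial representations to arrow families and back are
inverse: on the identity arrow of B, the idempotent of r acts by 1 if r lies in
B and by 0 otherwise, so the vertex idempotent of A picks out B = A. *)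
Lemma arrow_rep_arrow A g : par_arrow arrow_rep A g = v A g.
Proof.
have dom_v r B : par_dom arrow_rep r * v B 1%g = (r \in B)%:R * v B 1%g.
  rewrite /par_dom -mulrA arrow_repM mulg1.
  case: ifPn => [B1|nB1]; last by rewrite (arrow0 v_fam) ?mulr0 // (negPf nB1).
  rewrite arrow_repM mulVg; case: ifP; rewrite ?mul1r ?mul0r //.
have vertex_v B : par_vertex arrow_rep A * v B 1%g = if A == B then v B 1%g else 0.
  case: eqP => [<-|/eqP nAB].
    rewrite /par_vertex; elim: (index_enum gT) => [|r l IHl].
      by rewrite big_nil mul1r.
    rewrite big_cons -mulrA IHl /par_coord; case: ifP => rA.
      by rewrite dom_v rA mul1r.
    by rewrite mulrBl mul1r dom_v rA mul0r subr0.
  have [r rAB] : exists r, (r \in A) != (r \in B).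
    apply/existsP; apply: contraR nAB => /existsPn eqAB; apply/eqP/setP=> r.
    by apply/eqP; have := eqAB r; rewrite negbK.
  have := vertex_dom arrow_rep_partial A r.
  move=> /(congr1 (fun x => x * v B 1%g)).
  rewrite /= -[LHS]mulrA dom_v -[RHS]mulrA.
  case: (r \in A) (r \in B) rAB => -[] // _; rewrite ?(mul0r, mul1r, mulr0) //.
have vertex_e : par_vertex arrow_rep A = v A 1%g.
  rewrite -[LHS]mulr1 -(arrow_sum v_fam) mulr_sumr (bigD1 A) //= vertex_v eqxx.
  by rewrite big1 ?addr0 // => B; rewrite vertex_v eq_sym => /negPf->.
rewrite /par_arrow vertex_e arrow_repM mulg1; case: ifPn => // nA1.
by rewrite (arrow0 v_fam) // (negPf nA1).
Qed.

End ArrowFamily.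

Section KparArrows.
Variables (K : fieldType) (gT : finGroupType).

Lemma ksym_rep : partial_rep (ksym K (G := gT)).
Proof. by split; [exact: ksym1 | exact: ksym_left | exact: ksym_right]. Qed.

Definition karrow := par_arrow (ksym K (G := gT)).

Lemma karrow_family : arrow_family karrow.
Proof. exact/par_arrow_family/ksym_rep. Qed.

Lemma rmorph_par_arrow (A B : algType K) (f : {lrmorphism A -> B}) (p : gT -> A) C g :
  f (par_arrow p C g) = par_arrow (fun x => f (p x)) C g.
Proof.
rewrite /par_arrow rmorphM rmorph_prod; congr (_ * _); apply: eq_bigr => r _.
by rewrite /par_coord; case: ifP; rewrite ?rmorphB ?rmorph1 /par_dom rmorphM.
Qed.

(** Existence in the universal property of the groupoid algebra, with
Kpar_arrow_ext as uniqueness. *)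
Lemma Kpar_arrow_lift (A : algType K) (v : {set gT} -> gT -> A) : arrow_family v ->
  exists f : {lrmorphism Kpar K gT -> A}, forall C g, f (karrow C g) = v C g.
Proof.
move=> v_fam; have [v1 vl vr] := arrow_rep_partial v_fam.
have [f [fE _]] := KparP v1 vl vr.
exists f => C g; rewrite -(arrow_rep_arrow v_fam) rmorph_par_arrow.
by rewrite /par_arrow fE; congr (_ * _); apply: eq_bigr => r _; rewrite /par_coord /par_dom !fE.
Qed.

Lemma Kpar_arrow_ext (A : algType K) (f f' : {lrmorphism Kpar K gT -> A}) :
  (forall C g, f (karrow C g) = f' (karrow C g)) -> f =1 f'.
Proof.
move=> ff'; apply: Kpar_ext => g; rewrite (prep_sum_arrow (ksym K (G := gT)) g).
by rewrite !raddf_sum; apply: eq_bigr => C _; exact: ff'.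
Qed.

End KparArrows.

(** * Isomorphisms of partial group algebras from functors *)

(** The objects other than the full subset. They form a union of components of
the groupoid. *)
Definition vertex (gT : finGroupType) (A : {set gT}) :=
  (1%g \in A) && (A != [set: gT]).

Lemma vertex_move (gT : finGroupType) (A : {set gT}) g :
  vertex A -> g \in A -> vertex (A :* g^-1)%g.
Proof.
case/andP=> _ nAT gA; rewrite /vertex mem_rcoset invgK mul1g gA /=.
apply: contraNneq nAT => AgT; apply/eqP/setP=> x.
by rewrite inE; have := in_setT (x * g^-1)%g; rewrite -AgT mem_rcoset invgK mulgKV.
Qed.

(** A functor between the groupoids of proper subsets: Fo on objects, and F A g
on the arrow g out of A. Compatibility with identities follows from vf_comp. *)
Record vertex_functor (gT1 gT2 : finGroupType)
    (Fo : {set gT1} -> {set gT2}) (F : {set gT1} -> gT1 -> gT2) : Prop :=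
  VertexFunctor {
    vf_vertex A : vertex A -> vertex (Fo A);
    vf_dom A g : vertex A -> g \in A -> F A g \in Fo A;
    vf_move A g : vertex A -> g \in A -> Fo (A :* g^-1)%g = (Fo A :* (F A g)^-1)%g;
    vf_comp A g h : vertex A -> g \in A -> (h * g)%g \in A ->
      F A (h * g)%g = (F (A :* g^-1)%g h * F A g)%g
  }.

Definition inverse_functor (gT1 gT2 : finGroupType)
    (Fo : {set gT1} -> {set gT2}) (F : {set gT1} -> gT1 -> gT2)
    (Fo' : {set gT2} -> {set gT1}) (F' : {set gT2} -> gT2 -> gT1) :=
  forall A, vertex A ->
    Fo' (Fo A) = A /\ forall g, g \in A -> F' (Fo A) (F A g) = g.

(** A functor on the proper subsets together with a multiplicative family w on
the full subset pulls arrow families back. The inverse functor serves to see that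
every object is reached exactly once, hence that the identities sum to 1, and
that different objects have orthogonal images. *)
Section Transfer.
Variables (gT1 gT2 : finGroupType) (R : nzRingType).
Variables (k : {set gT2} -> gT2 -> R).
Hypothesis k_fam : arrow_family k.
Variables (Fo : {set gT1} -> {set gT2}) (F : {set gT1} -> gT1 -> gT2).
Variables (Fo' : {set gT2} -> {set gT1}) (F' : {set gT2} -> gT2 -> gT1).
Hypotheses (Ffun : vertex_functor Fo F) (F'fun : vertex_functor Fo' F').
Hypotheses (FK : inverse_functor Fo F Fo' F') (F'K : inverse_functor Fo' F' Fo F).

Variable w : gT1 -> R.
Hypotheses (w1 : w 1%g = k setT 1%g) (wM : forall g h, w g * w h = w (g * h)%g).

Definition transfer (A : {set gT1}) (g : gT1) : R :=
  if (1%g \in A) && (g \in A) then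
    if A == setT then w g else k (Fo A) (F A g)
  else 0.

Lemma functor1 (A : {set gT1}) : vertex A -> F A 1%g = 1%g.
Proof.
move=> vA; have A1 : 1%g \in A by case/andP: vA.
apply: (mulgI (F A 1%g)); have := vf_comp Ffun (g := 1%g) (h := 1%g) vA A1.
by rewrite !mulg1 invg1 rcoset1 => /(_ A1) <-.
Qed.

Let w1l g : k setT 1%g * w g = w g. Proof. by rewrite -w1 wM mul1g. Qed.
Let w1r g : w g * k setT 1%g = w g. Proof. by rewrite -w1 wM mulg1. Qed.

Let rcosetT g : [set: gT1] = ([set: gT1] :* g)%g.
Proof. by apply/setP=> x; rewrite mem_rcoset !inE. Qed.

Let rcosetT2 g : [set: gT2] = ([set: gT2] :* g)%g.
Proof. by apply/setP=> x; rewrite mem_rcoset !inE. Qed.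

Lemma transferM (A B : {set gT1}) (g h : gT1) : 1%g \in B -> h \in B ->
  transfer A g * transfer B h =
  if A == (B :* h^-1)%g then transfer B (g * h)%g else 0.
Proof.
move=> B1 hB; rewrite {2}/transfer B1 hB /=.
have [->|nBT] := eqVneq B setT.
  rewrite -rcosetT; have [->|nAT] := eqVneq A setT.
    by rewrite /transfer !inE eqxx wM.
  rewrite /transfer (negPf nAT); case: ifP => [/andP[A1 gA]|_]; last by rewrite mul0r.
  have vA : vertex A by rewrite /vertex A1.
  have /andP[_ nFT] := vf_vertex Ffun vA.
  by rewrite -w1l mulrA (arrowM k_fam) ?inE // -rcosetT2 (negPf nFT) mul0r.
have vB : vertex B by rewrite /vertex B1.
have /andP[F1 nFT] := vf_vertex Ffun vB; have Fh := vf_dom Ffun vB hB.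
have [->|nAB] := eqVneq A (B :* h^-1)%g.
  have vA := vertex_move vB hB; have /andP[A1 nAT] := vA.
  rewrite /transfer A1 B1 (negPf nAT) (negPf nBT) mem_rcoset invgK /=.
  case: ifP => [ghB|_]; last by rewrite mul0r.
  by rewrite (arrowM k_fam) // -(vf_move Ffun) // eqxx -(vf_comp Ffun).
rewrite /transfer; case: ifP => [/andP[A1 gA]|_]; last by rewrite mul0r.
case: (eqVneq A setT) => [_|nAT].
  rewrite -w1r -mulrA (arrowM k_fam) // ifN ?mulr0 //.
  apply: contraNneq nFT => TF; apply/eqP/setP=> x; rewrite inE.
  have := in_setT (x * (F B h)^-1)%g.
  by rewrite TF mem_rcoset invgK mulgKV.
have vA : vertex A by rewrite /vertex A1.
rewrite (arrowM k_fam) // ifN // -(vf_move Ffun) //; apply: contraNneq nAB => FAB.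
by rewrite -(FK vA).1 FAB (FK (vertex_move vB hB)).1.
Qed.

Lemma transfer_family : arrow_family transfer.
Proof.
split=> [A g||]; [by move/negPf; rewrite /transfer => -> | exact: transferM |].
rewrite -[RHS](arrow_sum k_fam) (bigD1 setT) //= [RHS](bigD1 setT) //=.
congr (_ + _); first by rewrite /transfer !inE eqxx.
rewrite (bigID (fun A : {set gT1} => 1%g \in A)) /= addrC big1 ?add0r; last first.
  by move=> A /andP[_ /negPf nA1]; rewrite /transfer nA1.
rewrite [RHS](bigID (fun A : {set gT2} => 1%g \in A)) /= [RHS]addrC.
rewrite [X in _ = X + _]big1 ?add0r; last first.
  by move=> A /andP[_ /negPf nA1]; rewrite (arrow0 k_fam) ?nA1.
rewrite [RHS](reindex_onto Fo Fo') /=; last first.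
  by move=> A /andP[nAT A1]; apply: (F'K _).1; rewrite /vertex A1.
apply: eq_big => [A|A /andP[nAT A1]]; last first.
  rewrite /transfer A1 (negPf nAT) functor1 // /vertex A1 //.
rewrite [LHS]andbC [X in _ = X && _]andbC -!/(vertex _).
apply/idP/idP => [vA|/andP[vFA /eqP<-]]; last exact: vf_vertex F'fun _ vFA.
by rewrite (vf_vertex Ffun vA) (FK vA).1 eqxx.
Qed.

Lemma transfer_arrow A g : vertex A -> g \in A -> transfer A g = k (Fo A) (F A g).
Proof. by case/andP=> A1 nAT gA; rewrite /transfer A1 gA (negPf nAT). Qed.

Lemma transfer_full g : transfer setT g = w g.
Proof. by rewrite /transfer !inE eqxx. Qed.

End Transfer.

(** The matrix M defines a morphism between group algebras, tested on every
multiplicative family t instead of on a group algebra: t is not assumed to map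
1 to 1, so that it may be the family of arrows of the full subset, which lives in
a corner of the algebra. *)
Definition full_multiplicative (K : fieldType) (gT1 gT2 : finGroupType)
    (M : gT1 -> gT2 -> K) :=
  forall (A : algType K) (t : gT2 -> A), (forall g h, t g * t h = t (g * h)%g) ->
    \sum_x M 1%g x *: t x = t 1%g /\
    forall g h, (\sum_x M g x *: t x) * (\sum_x M h x *: t x)
      = \sum_x M (g * h)%g x *: t x.

Lemma arrow_full (gT : finGroupType) (R : nzRingType) (k : {set gT} -> gT -> R) :
  arrow_family k -> forall g h, k setT g * k setT h = k setT (g * h)%g.
Proof.
move=> k_fam g h; rewrite (arrowM k_fam) ?inE // ifT //; apply/eqP/setP=> x.
by rewrite mem_rcoset !inE.
Qed.

Lemma sum_inverse_mx (K : fieldType) (I J : finType) (V : lmodType K)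
    (N : I -> J -> K) (N' : J -> I -> K) (t : I -> V) g :
  (forall g h, \sum_x N g x * N' x h = (g == h)%:R) ->
  \sum_x N g x *: (\sum_y N' x y *: t y) = t g.
Proof.
move=> NN'; under eq_bigr do rewrite scaler_sumr.
rewrite exchange_big /= (bigD1 g) //=; under eq_bigr do rewrite scalerA.
rewrite -scaler_suml NN' eqxx scale1r big1 ?addr0 // => h ngh.
under eq_bigr do rewrite scalerA.
by rewrite -scaler_suml NN' eq_sym (negPf ngh) scale0r.
Qed.

(** The isomorphism follows the functor on the arrows of proper subsets and the
matrix M on the arrows of the full subset. *)
Lemma Kpar_iso (K : fieldType) (gT1 gT2 : finGroupType)
    Fo F Fo' F' (M : gT1 -> gT2 -> K) (M' : gT2 -> gT1 -> K) :
  @vertex_functor gT1 gT2 Fo F -> @vertex_functor gT2 gT1 Fo' F' ->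
  inverse_functor Fo F Fo' F' -> inverse_functor Fo' F' Fo F ->
  full_multiplicative M -> full_multiplicative M' ->
  (forall g h, \sum_x M g x * M' x h = (g == h)%:R) ->
  (forall g h, \sum_x M' g x * M x h = (g == h)%:R) ->
  exists f : {lrmorphism Kpar K gT1 -> Kpar K gT2}, bijective f.
Proof.
have half (T1 T2 : finGroupType) (N : T1 -> T2 -> K) Go G Go' G' :
  @vertex_functor T1 T2 Go G -> @vertex_functor T2 T1 Go' G' ->
  inverse_functor Go G Go' G' -> inverse_functor Go' G' Go G ->
  full_multiplicative N ->
  exists f : {lrmorphism Kpar K T1 -> Kpar K T2},
    (forall A g, vertex A -> g \in A -> f (karrow K A g) = karrow K (Go A) (G A g))
    /\ forall g, f (karrow K setT g) = \sum_x N g x *: karrow K setT x.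
  move=> Gf G'f GK G'K Nm.
  have [N1 NM] := Nm _ _ (arrow_full (karrow_family K T2)).
  have [f fE] := Kpar_arrow_lift
    (transfer_family (karrow_family K T2) Gf G'f GK G'K N1 NM).
  exists f; split=> [A g vA gA|g]; rewrite fE; first exact: transfer_arrow.
  exact: transfer_full.
have inv (T1 T2 : finGroupType) (N : T1 -> T2 -> K) (N' : T2 -> T1 -> K) Go G Go' G'
    (f : {lrmorphism Kpar K T1 -> Kpar K T2}) (f' : {lrmorphism Kpar K T2 -> Kpar K T1}) :
  @vertex_functor T1 T2 Go G -> inverse_functor Go G Go' G' ->
  (forall g h, \sum_x N g x * N' x h = (g == h)%:R) ->
  (forall A g, vertex A -> g \in A -> f (karrow K A g) = karrow K (Go A) (G A g)) ->
  (forall A g, vertex A -> g \in A -> f' (karrow K A g) = karrow K (Go' A) (G' A g)) ->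
  (forall g, f (karrow K setT g) = \sum_x N g x *: karrow K setT x) ->
  (forall g, f' (karrow K setT g) = \sum_x N' g x *: karrow K setT x) ->
  cancel f f'.
  move=> Gf GK NN' fv f'v fT f'T.
  apply: (Kpar_arrow_ext (f := f' \o f) (f' := idfun)) => C g /=.
  have [|nC] := boolP ((1%g \in C) && (g \in C)); last first.
    by rewrite (arrow0 (karrow_family K T1) nC) !raddf0.
  case/andP=> C1 gC; have [->|nCT] := eqVneq C setT.
    rewrite fT raddf_sum /= -[RHS](sum_inverse_mx (karrow K setT) g NN').
    by apply: eq_bigr => x _; rewrite linearZ /= f'T.
  have vC : vertex C by rewrite /vertex C1.
  rewrite (fv _ _ vC gC) (f'v _ _ (vf_vertex Gf vC) (vf_dom Gf vC gC)).
  by have [-> ->] := GK _ vC.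
move=> Ff F'f FK F'K Mm M'm MM' M'M.
have [f [fv fT]] := half _ _ _ _ _ _ _ Ff F'f FK F'K Mm.
have [f' [f'v f'T]] := half _ _ _ _ _ _ _ F'f Ff F'K FK M'm.
exists f; exists f'.
  exact: inv Ff FK MM' fv f'v fT f'T.
exact: inv F'f F'K M'M f'v fv f'T fT.
Qed.

Local Close Scope ring_scope.
Local Open Scope group_scope.

(** * Subsets of a group with a given stabilizer *)

Lemma card_fibers (T U : finType) (f : T -> U) (A : {set T}) m :
  (forall x, x \in A -> #|[set y in A | f y == f x]| = m) -> #|A| = (#|f @: A| * m)%N.
Proof.
move=> fib; rewrite -sum1_card (partition_big_imset f) /= -sum_nat_const.
apply: eq_bigr => _ /imsetP[x xA ->]; rewrite -(fib x xA) -sum1_card.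
by apply: eq_bigl => y; rewrite inE.
Qed.

(** The default values x1 and x2 are only there to index into the fibers. *)
Lemma key_bijection (T1 T2 : finType) (Z : eqType) (x1 : T1) (x2 : T2)
    (A1 : {set T1}) (A2 : {set T2}) (k1 : T1 -> Z) (k2 : T2 -> Z) :
  (forall z, #|[set x in A1 | k1 x == z]| = #|[set x in A2 | k2 x == z]|) ->
  exists f : T1 -> T2, exists g : T2 -> T1,
    (forall x, x \in A1 -> [/\ f x \in A2, k2 (f x) = k1 x & g (f x) = x]) /\
    (forall x, x \in A2 -> [/\ g x \in A1, k1 (g x) = k2 x & f (g x) = x]).
Proof.
move=> k12; pose E1 z := enum [set x in A1 | k1 x == z].
pose E2 z := enum [set x in A2 | k2 x == z].
exists (fun x => nth x2 (E2 (k1 x)) (index x (E1 (k1 x)))).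
exists (fun x => nth x1 (E1 (k2 x)) (index x (E2 (k2 x)))).
have sz z : size (E1 z) = size (E2 z) by rewrite -!cardE k12.
split=> x xA.
  have xE : x \in E1 (k1 x) by rewrite mem_enum inE xA eqxx.
  have lt : index x (E1 (k1 x)) < size (E2 (k1 x)) by rewrite -sz index_mem.
  have := mem_nth x2 lt; rewrite mem_enum inE => /andP[-> /eqP kf]; split=> //.
  by rewrite kf index_uniq ?enum_uniq // nth_index.
have xE : x \in E2 (k2 x) by rewrite mem_enum inE xA eqxx.
have lt : index x (E2 (k2 x)) < size (E1 (k2 x)) by rewrite sz index_mem.
have := mem_nth x1 lt; rewrite mem_enum inE => /andP[-> /eqP kf]; split=> //.
by rewrite kf index_uniq ?enum_uniq // nth_index.
Qed.

Section Stabilizer.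
Variable gT : finGroupType.
Implicit Types (S : {set gT}) (H : {group gT}).

(** The stabilizer under right translation. *)
Definition stab S : {group gT} := 'C[S | 'Rs]%G.

Lemma stabP S h : reflect (S :* h = S) (h \in stab S).
Proof. by rewrite !inE sub1set inE /= rcosetE; exact: eqP. Qed.

Lemma stab_mul S x h : h \in stab S -> (x * h \in S) = (x \in S).
Proof. by move/groupVr/stabP=> Sh; rewrite -{2}Sh mem_rcoset invgK. Qed.

Lemma sub_stabP S H :
  reflect {in S & H, forall x h, x * h \in S} (H \subset stab S).
Proof.
apply: (iffP subsetP) => [HS x h xS /HS hS|SH h hH]; first by rewrite stab_mul.
apply/stabP/setP=> x; rewrite mem_rcoset; apply/idP/idP => [xS|xS].
  by rewrite -(mulgKV h x); exact: SH.
by apply: SH; rewrite ?groupV.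
Qed.

Lemma stab_rcoset S g : stab (S :* g) = (stab S :^ g)%G.
Proof. by apply/val_inj; rewrite /= -(astab1_act 'Rs%act) /= rcosetE. Qed.

(** These subsets are the unions of k / |H| left cosets of H, chosen freely among
all of them. *)
Lemma card_invariant_sets H k :
  #|[set S | (H \subset stab S) && (#|S| == k)]| =
  if #|H| %| k then 'C(#|[set: gT] : H|, k %/ #|H|) else 0%N.
Proof.
pose U (P : {set {set gT}}) := [set x | x *: H \in P].
have U_card (P : {set {set gT}}) : P \subset lcosets H setT -> #|U P| = (#|P| * #|H|)%N.
  move=> PL; rewrite (@card_fibers _ _ (fun x => x *: H) _ #|H|).
    congr (_ * _)%N; apply: eq_card => C; apply/imsetP/idP => [[x + ->]|CP].
      by rewrite inE.
    have /lcosetsP[x _ Cx] := subsetP PL C CP.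
    by exists x; rewrite // inE -Cx.
  move=> x; rewrite inE => xP; rewrite -(card_lcoset H x); apply: eq_card => y.
  rewrite !inE; apply/andP/idP => [[_ /eqP<-]|xy]; first exact: lcoset_refl.
  by rewrite (lcoset_eqP xy).
have U_inj : {in powerset (lcosets H setT) &, injective U}.
  move=> P Q; rewrite !inE => PL QL UPQ; apply/setP=> C.
  apply/idP/idP => CP.
    have /lcosetsP[x _ Cx] := subsetP PL C CP.
    by move/setP/(_ x): UPQ; rewrite !inE -Cx CP => <-.
  have /lcosetsP[x _ Cx] := subsetP QL C CP.
  by move/setP/(_ x): UPQ; rewrite !inE -Cx CP => ->.
have -> : [set S | (H \subset stab S) && (#|S| == k)] =
    U @: [set P in powerset (lcosets H setT) | (#|P| * #|H| == k)%N].
  apply/setP=> S; rewrite inE; apply/andP/imsetP => [[/sub_stabP HS /eqP Sk]|].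
    have SU : S = U [set x *: H | x in S].
      apply/setP=> x; rewrite inE; apply/idP/imsetP => [xS|[y yS /lcoset_eqP]].
        by exists x.
      by case/lcosetP=> h hH ->; exact: HS.
    have sub : [set x *: H | x in S] \subset lcosets H setT.
      by apply/subsetP=> _ /imsetP[x _ ->]; apply/lcosetsP; exists x.
    by exists [set x *: H | x in S]; rewrite // !inE sub -U_card // -SU Sk eqxx.
  case=> P; rewrite !inE => /andP[PL Pk] ->; rewrite U_card //; split=> //.
  apply/sub_stabP=> x h; rewrite !inE lcosetM => xP hH.
  by rewrite [h *: H]lcoset_id.
rewrite card_in_imset; last first.
  by move=> P Q; rewrite !inE => /andP[PL _] /andP[QL _]; apply: U_inj; rewrite inE.
rewrite -card_lcosets; case: ifPn => [Hk|nHk]; last first.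
  apply/eqP; rewrite cards_eq0; apply/eqP/setP=> P; rewrite !inE.
  by apply: contraNF nHk => /andP[_ /eqP<-]; exact: dvdn_mull.
rewrite -cards_draws; apply: eq_card => P; rewrite !inE; congr (_ && _).
by rewrite -[k in LHS](divnK Hk) eqn_pmul2r ?cardG_gt0.
Qed.

End Stabilizer.

Arguments stab : simpl never.

(** The number of subsets of size k whose stabilizer is exactly H. *)
Definition nb_stab (gT : finGroupType) (H : {group gT}) k :=
  #|[set S : {set gT} | (stab S == H) && (#|S| == k)]|.

Lemma sum_nb_stab (gT : finGroupType) (H : {group gT}) k :
  #|[set S : {set gT} | (H \subset stab S) && (#|S| == k)]| =
  (\sum_(B : {group gT} | H \subset B) nb_stab B k)%N.
Proof.
rewrite -sum1_card (partition_big (@stab gT) (fun B : {group gT} => H \subset B)) /=.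
  apply: eq_bigr => B HB; rewrite /nb_stab -sum1_card; apply: eq_bigl => S.
  rewrite !inE; case: (eqVneq (stab S) B) HB => [<- ->|_ _]; rewrite ?andbT ?andbF //.
by move=> S; rewrite inE => /andP[].
Qed.

Section Matching.
Variables (gT1 gT2 : finGroupType).
Hypothesis card12 : #|gT1| = #|gT2|.
Variables (phi : {group gT1} -> {group gT2}) (phi' : {group gT2} -> {group gT1}).
Hypotheses (phiK : cancel phi phi') (phi'K : cancel phi' phi).
Hypothesis card_phi : forall H, #|phi H| = #|H|.
Hypothesis phiS : forall H B, (phi H \subset phi B) = (H \subset B).

(** A set fixed by H has a stabilizer containing H. As the number of sets fixed
by H is the same on both sides, and as the terms of the strictly larger
stabilizers agree by induction, the terms of H itself agree. *)
Lemma nb_stab_lattice H k : nb_stab H k = nb_stab (phi H) k.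
Proof.
have [n] := ubnP (#|gT1| - #|H|); elim: n H => // n IHn H ltn.
have : (\sum_(B : {group gT1} | H \subset B) nb_stab B k =
        \sum_(B : {group gT2} | phi H \subset B) nb_stab B k)%N.
  rewrite -!sum_nb_stab !card_invariant_sets card_phi -!divgS ?subsetT //.
  by rewrite !cardsT card12 card_phi.
rewrite (bigD1 H) //= [RHS](bigD1 (phi H)) //= [X in _ = (_ + X)%N -> _](reindex phi) /=;
  last by exists phi' => B _.
under [X in _ = (_ + X)%N -> _]eq_bigl => B do rewrite phiS (can_eq phiK).
under eq_bigr => B /andP[HB nBH].
  rewrite IHn; last first.
    have ltHB : #|H| < #|B| by rewrite proper_card // properEneq eq_sym nBH.
    rewrite ltnS in ltn; apply: leq_trans ltn; apply: ltn_sub2l => //.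
    exact: leq_trans ltHB (max_card _).
over.
exact: addIn.
Qed.

(** Subsets of size k whose stabilizer has order h: the components of such
subsets all have k / h objects and a vertex group of order h. *)
Definition nb_type (gT : finGroupType) h k :=
  #|[set S : {set gT} | (#|stab S| == h) && (#|S| == k)]|.

Lemma nb_typeE (gT : finGroupType) h k :
  nb_type gT h k = (\sum_(H : {group gT} | #|H| == h) nb_stab H k)%N.
Proof.
rewrite /nb_type -sum1_card.
rewrite (partition_big (@stab gT) (fun H : {group gT} => #|H| == h)) /=.
  apply: eq_bigr => H Hh; rewrite /nb_stab -sum1_card; apply: eq_bigl => S.
  by rewrite !inE; case: (eqVneq (stab S) H) Hh => [<- ->|_ _]; rewrite ?andbT ?andbF.
by move=> S; rewrite inE => /andP[].
Qed.

Lemma nb_type_eq h k : nb_type gT1 h k = nb_type gT2 h k.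
Proof.
rewrite !nb_typeE [RHS](reindex phi) /=; last by exists phi' => B _.
by apply: eq_big => [H|H _]; rewrite ?card_phi // nb_stab_lattice.
Qed.

End Matching.

Section Representatives.
Variable gT : finGroupType.
Implicit Types (S A : {set gT}).

(** A chosen representative of the orbit of A under right translation. *)
Definition orep A : {set gT} := odflt A [pick S in orbit 'Rs setT A].

Lemma orep_rcoset A g : orep (A :* g) = orep A.
Proof.
rewrite /orep; have -> : orbit 'Rs setT (A :* g) = orbit 'Rs setT A.
  by rewrite -rcosetE; exact: (orbit_act 'Rs%act A (in_setT g)).
by case: pickP => // /(_ A); rewrite orbit_refl.
Qed.

Lemma orep_exists A : exists x, A == orep A :* x^-1.
Proof.
rewrite /orep; case: pickP => [S|_] /=; last by exists 1; rewrite invg1 rcoset1.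
by case/orbitP=> x _ <-; exists x; rewrite /= rcosetE rcosetK.
Qed.

Definition orep_elt A : gT := xchoose (orep_exists A).

Lemma orep_eltP A : A = orep A :* (orep_elt A)^-1.
Proof. exact/eqP/(xchooseP (orep_exists A)). Qed.

Lemma orepK A : orep (orep A) = orep A.
Proof. by rewrite [in RHS](orep_eltP A) orep_rcoset. Qed.

Lemma card_stab_orep A : #|stab (orep A)| = #|stab A|.
Proof. by rewrite [in RHS](orep_eltP A) stab_rcoset cardJg. Qed.

Lemma card_orep A : #|orep A| = #|A|.
Proof. by rewrite [in RHS](orep_eltP A) card_rcoset. Qed.

Definition oreps h k :=
  [set S | [&& orep S == S, #|stab S| == h & #|S| == k]].

(** Each orbit of a set with stabilizer of order h has |G| / h elements, all of
the same type. *)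
Lemma card_oreps h k : (nb_type gT h k * h = #|oreps h k| * #|gT|)%N.
Proof.
pose X := [set S : {set gT} | (#|stab S| == h) && (#|S| == k)].
have [X0|[S0 S0X]] := set_0Vmem X.
  rewrite /nb_type -/X X0 cards0; suff -> : oreps h k = set0 by rewrite cards0.
  apply/setP=> S; have := in_set0 S; rewrite -X0 !inE => ->.
  by rewrite andbF.
have h_dvd : (#|gT| %/ h * h = #|gT|)%N.
  move: S0X; rewrite inE => /andP[/eqP<- _].
  by rewrite divnK // -cardsT cardSg ?subsetT.
have h_gt0 : 0 < h by move: S0X; rewrite inE => /andP[/eqP<- _]; exact: cardG_gt0.
have -> : oreps h k = @orep @: X.
  apply/setP=> S; rewrite inE; apply/and3P/imsetP => [[/eqP oS Sh Sk]|[A]].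
    by exists S; rewrite // inE Sh.
  by rewrite inE => /andP[Ah Ak] ->; rewrite orepK card_stab_orep card_orep.
rewrite /nb_type -/X (@card_fibers _ _ orep X (#|gT| %/ h)) -?mulnA ?h_dvd //.
move=> S; rewrite inE => /andP[/eqP Sh /eqP Sk].
have -> : [set A in X | orep A == orep S] = orbit 'Rs setT S.
  apply/setP=> A; rewrite !inE; apply/andP/orbitP => [[_ /eqP AS]|[x _ <-]].
    exists ((orep_elt S) * (orep_elt A)^-1); rewrite ?inE //= rcosetE.
    by rewrite rcosetM {1}(orep_eltP S) rcosetKV -AS -orep_eltP.
  rewrite -[act _ _ _]/(rcoset S x) rcosetE.
  by rewrite orep_rcoset stab_rcoset cardJg card_rcoset Sh Sk !eqxx.
have := card_orbit_stab 'Rs%act [set: gT]%G S; rewrite setTI cardsT -Sh => <-.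
by rewrite mulnK // cardG_gt0.
Qed.

End Representatives.

(** * Equivariant bijections and functors between groupoids of subsets *)

Section CosetRep.
Variables (gT : finGroupType) (H : {group gT}).

Definition coset_rep x := repr (x *: H).

Lemma coset_repP x : exists2 h, h \in H & coset_rep x = x * h.
Proof. by apply/lcosetP; apply: (mem_repr x); exact: lcoset_refl. Qed.

Lemma coset_repM x h : h \in H -> coset_rep (x * h) = coset_rep x.
Proof. by move=> hH; rewrite /coset_rep lcosetM (lcoset_id hH). Qed.

Lemma coset_repK x : coset_rep (coset_rep x) = coset_rep x.
Proof. by have [h hH e] := coset_repP x; rewrite {1}e coset_repM. Qed.

Lemma coset_rep_lcoset x : coset_rep x *: H = x *: H.
Proof. by have [h hH ->] := coset_repP x; rewrite lcosetM (lcoset_id hH). Qed.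

Lemma coset_repV x : (coset_rep x)^-1 * x \in H.
Proof. by have [h hH ->] := coset_repP x; rewrite invgM mulgKV groupV. Qed.

Variable S : {set gT}.
Hypothesis HS : H \subset stab S.

Lemma coset_rep_in x : (coset_rep x \in S) = (x \in S).
Proof. by have [h /(subsetP HS) hS ->] := coset_repP x; rewrite stab_mul. Qed.

Lemma coset_rep_im x : x \in coset_rep @: S -> x \in S /\ coset_rep x = x.
Proof. by case/imsetP=> y yS ->; rewrite coset_rep_in coset_repK. Qed.

Lemma card_coset_rep : #|S| = (#|coset_rep @: S| * #|H|)%N.
Proof.
apply: card_fibers => x xS; rewrite -(card_lcoset H x).
apply: eq_card => y; rewrite inE; apply/andP/idP => [[_ /eqP yx]|].
  by apply/lcoset_eqP; rewrite -coset_rep_lcoset yx coset_rep_lcoset.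
case/lcosetP=> h hH ->.
by rewrite coset_repM // eqxx stab_mul // (subsetP HS).
Qed.

End CosetRep.

Section CosetMap.
Variables (gT1 gT2 : finGroupType) (H1 : {group gT1}).

(** Every x is t h with t the representative of x H and h in H; its image is
u(t) i(h). *)
Definition coset_map (u i : gT1 -> gT2) x :=
  u (coset_rep H1 x) * i ((coset_rep H1 x)^-1 * x).

Lemma coset_mapM (u i : gT1 -> gT2) x h :
  {in H1 &, {morph i : y z / y * z}} -> h \in H1 ->
  coset_map u i (x * h) = coset_map u i x * i h.
Proof.
by move=> iM hH; rewrite /coset_map coset_repM // mulgA iM ?coset_repV ?mulgA.
Qed.
End CosetMap.

Lemma coset_mapK (gT1 gT2 : finGroupType)
    (H1 : {group gT1}) (H2 : {group gT2}) (S1 : {set gT1}) (S2 : {set gT2})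
    (u i : gT1 -> gT2) (u' i' : gT2 -> gT1) :
  H1 \subset stab S1 -> H2 \subset stab S2 ->
  {in H1, forall h, i h \in H2 /\ i' (i h) = h} ->
  {in coset_rep H1 @: S1, forall x, u x \in coset_rep H2 @: S2 /\ u' (u x) = x} ->
  forall x, x \in S1 ->
    coset_map H1 u i x \in S2 /\ coset_map H2 u' i' (coset_map H1 u i x) = x.
Proof.
move=> HS1 HS2 iK uK x xS; rewrite {2 3}/coset_map.
have [uT u'u] := uK _ (imset_f (coset_rep H1) xS).
have [uS urep] := coset_rep_im HS2 uT.
have [iH i'i] := iK _ (coset_repV H1 x).
rewrite /coset_map coset_repM // urep mulKg u'u i'i mulKVg.
by rewrite stab_mul ?(subsetP HS2).
Qed.

(** S1 and S2 are free right sets over isomorphic groups, with equally many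
orbits: match the orbit representatives, and transport the rest by the
isomorphism. *)
Lemma equivariant_bijection (gT1 gT2 : finGroupType)
    (H1 : {group gT1}) (H2 : {group gT2}) (S1 : {set gT1}) (S2 : {set gT2}) :
  H1 \isog H2 -> H1 \subset stab S1 -> H2 \subset stab S2 -> #|S1| = #|S2| ->
  exists b : gT1 -> gT2, exists b' : gT2 -> gT1,
  exists i : gT1 -> gT2, exists i' : gT2 -> gT1,
  [/\ forall x, x \in S1 -> b x \in S2 /\ b' (b x) = x,
      forall x, x \in S2 -> b' x \in S1 /\ b (b' x) = x,
      forall x h, h \in H1 -> i h \in H2 /\ b (x * h) = b x * i h &
      forall x h, h \in H2 -> i' h \in H1 /\ b' (x * h) = b' x * i' h].
Proof.
case/isogP=> f f_inj fH12 HS1 HS2 S12; pose f' := invm f_inj.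
have fH h : h \in H1 -> f h \in H2 by move=> hH; rewrite -fH12 mem_morphim.
have f'H h : h \in H2 -> f' h \in H1.
  by rewrite -fH12 => hH; rewrite -(im_invm f_inj) mem_morphim.
have fK h : h \in H1 -> f' (f h) = h by move=> hH; exact: invmE.
have f'K h : h \in H2 -> f (f' h) = h by rewrite -fH12 => hH; exact: invmK.
have fM : {in H1 &, {morph f : y z / y * z}} by move=> y z yH zH; rewrite morphM.
have f'M : {in H2 &, {morph f' : y z / y * z}}.
  by rewrite -fH12 => y z yH zH; rewrite /f' morphM.
have T12 : #|coset_rep H1 @: S1| = #|coset_rep H2 @: S2|.
  apply/eqP; rewrite -(eqn_pmul2r (cardG_gt0 H1)) -card_coset_rep // S12.
  by rewrite (card_coset_rep HS2) -fH12 card_injm.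
have [|u [u' [uP u'P]]] := @key_bijection _ _ nat 1 1
    (coset_rep H1 @: S1) (coset_rep H2 @: S2) (fun=> 0) (fun=> 0).
  by move=> z; rewrite !setIdE; case: (0 == z); rewrite ?setIT ?setI0 ?cards0.
exists (coset_map H1 u f), (coset_map H2 u' f'), f, f'; split=> [x xS|x xS|x h hH|x h hH].
- apply: (coset_mapK HS1 HS2) => // y yT; first by rewrite fH ?fK.
  by have [] := uP y yT.
- apply: (coset_mapK HS2 HS1) => // y yT; first by rewrite f'H ?f'K.
  by have [] := u'P y yT.
- by rewrite fH // coset_mapM.
- by rewrite f'H // coset_mapM.
Qed.

(** Representatives of the nonempty proper subsets. The condition on the
stabilizer excludes exactly the empty set and the full set, which are the only
sets fixed by all translations. *)
Definition vertex_reps (gT : finGroupType) : {set {set gT}} :=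
  [set S | (orep S == S) && (stab S != [set: gT]%G)].

Lemma vertex_stab (gT : finGroupType) (A : {set gT}) :
  vertex A -> stab A != [set: gT]%G.
Proof.
case/andP=> A1 nAT; apply: contraNneq nAT => sA; apply/eqP/setP=> x.
by rewrite inE -[x]mul1g stab_mul // sA inE.
Qed.

Lemma orep_vertex (gT : finGroupType) (A : {set gT}) :
  vertex A -> orep A \in vertex_reps gT.
Proof.
move=> vA; rewrite inE orepK eqxx; apply: contraNneq (vertex_stab vA) => sA.
apply/eqP/val_inj/eqP; rewrite eqEcard subsetT /= -card_stab_orep sA.
by rewrite leqnn.
Qed.

(** The data that relate the component of each representative S to that of
rho S: an equivariant map b S from S to rho S, along the map i S of the
stabilizers. *)
Record orbit_matching (gT1 gT2 : finGroupType) (rho : {set gT1} -> {set gT2})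
    (b i : {set gT1} -> gT1 -> gT2) : Prop := OrbitMatching {
  om_rep S : S \in vertex_reps gT1 -> orep (rho S) = rho S /\ #|rho S| = #|S|;
  om_in S x : S \in vertex_reps gT1 -> x \in S -> b S x \in rho S;
  om_stab S h : S \in vertex_reps gT1 -> h \in stab S -> i S h \in stab (rho S);
  om_mul S x h : S \in vertex_reps gT1 -> h \in stab S ->
     b S (x * h) = b S x * i S h
}.

(** The objects of the component of S are the S x^-1 with x in S, and an arrow
from S x^-1 to S y^-1 is g = y x^-1. The functor sends S x^-1 to
rho(S) b(x)^-1 and the arrow y x^-1 to b(y) b(x)^-1. *)
Section Functor.
Variables (gT1 gT2 : finGroupType) (rho : {set gT1} -> {set gT2}).
Variables (b i : {set gT1} -> gT1 -> gT2).
Hypothesis card12 : #|gT1| = #|gT2|.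
Hypothesis M : orbit_matching rho b i.

Definition functor_obj (A : {set gT1}) : {set gT2} :=
  rho (orep A) :* (b (orep A) (orep_elt A))^-1.
Definition functor_map (A : {set gT1}) (g : gT1) : gT2 :=
  b (orep A) (g * orep_elt A) * (b (orep A) (orep_elt A))^-1.

Lemma orep_move (gT : finGroupType) (A : {set gT}) x : A = orep A :* x^-1 ->
  exists2 h, h \in stab (orep A) & orep_elt A = x * h.
Proof.
move=> Ax; exists (x^-1 * orep_elt A); last by rewrite mulKVg.
by apply/stabP; rewrite rcosetM -Ax {1}(orep_eltP A) rcosetKV.
Qed.

Lemma mem_orep_elt (gT : finGroupType) (A : {set gT}) g :
  (g \in A) = (g * orep_elt A \in orep A).
Proof. by rewrite {1}(orep_eltP A) mem_rcoset invgK. Qed.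

(** The functor does not depend on the choice of x with A = S x^-1: another
choice is x h with h in the stabilizer of S, and then b(x h) = b(x) i(h) with i(h)
in the stabilizer of rho(S). *)
Lemma functor_rep A x : vertex A -> A = orep A :* x^-1 ->
  functor_obj A = rho (orep A) :* (b (orep A) x)^-1 /\
  forall g, functor_map A g = b (orep A) (g * x) * (b (orep A) x)^-1.
Proof.
move=> vA /orep_move[h hS e]; have S_rep := orep_vertex vA.
have /stabP ihS := groupVr (om_stab M S_rep hS).
rewrite /functor_obj /functor_map e; split=> [|g].
  by rewrite (om_mul M) // invgM rcosetM ihS.
by rewrite (mulgA g) (om_mul M (g * x) S_rep hS) (om_mul M x S_rep hS) invgM mulgA mulgK.
Qed.

Lemma orep_act (A : {set gT1}) g : A = orep A :* (orep_elt A)^-1 ->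
  A :* g^-1 = orep (A :* g^-1) :* (g * orep_elt A)^-1.
Proof. by move=> e; rewrite orep_rcoset invgM rcosetM -e. Qed.

Lemma vertex_functor_obj : vertex_functor functor_obj functor_map.
Proof.
split=> [A vA|A g vA gA|A g vA gA|A g h vA gA hgA].
- have [A1 nAT] := andP vA; have S_rep := orep_vertex vA; apply/andP; split.
    rewrite mem_rcoset invgK mul1g (om_in M) //.
    by rewrite -[orep_elt A]mul1g -mem_orep_elt.
  apply: contraNneq nAT => FT; rewrite eqEcard subsetT cardsT card12 -cardsT -FT.
  by rewrite card_rcoset (om_rep M S_rep).2 card_orep leqnn.
- have S_rep := orep_vertex vA.
  by rewrite /functor_obj mem_rcoset invgK mulgKV (om_in M) // -mem_orep_elt.
- have vA' := vertex_move vA gA.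
  have [-> _] := functor_rep vA' (orep_act g (orep_eltP A)).
  rewrite orep_rcoset /functor_obj /functor_map invgM invgK.
  by rewrite -[in RHS]rcosetM mulKg.
- have vA' := vertex_move vA gA.
  have [_ ->] := functor_rep vA' (orep_act g (orep_eltP A)).
  by rewrite orep_rcoset /functor_map !mulgA mulgKV.
Qed.

End Functor.

Lemma inverse_functor_obj (gT1 gT2 : finGroupType)
    (rho : {set gT1} -> {set gT2}) (b i : {set gT1} -> gT1 -> gT2)
    (rho' : {set gT2} -> {set gT1}) (b' i' : {set gT2} -> gT2 -> gT1) :
  #|gT1| = #|gT2| ->
  orbit_matching rho b i -> orbit_matching rho' b' i' ->
  (forall S, S \in vertex_reps gT1 -> rho' (rho S) = S) ->
  (forall S x, S \in vertex_reps gT1 -> x \in S -> b' (rho S) (b S x) = x) ->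
  inverse_functor (functor_obj rho b) (functor_map b)
                  (functor_obj rho' b') (functor_map b').
Proof.
move=> card12 M M' rhoK bK A vA; have S_rep := orep_vertex vA.
have vFA := vf_vertex (vertex_functor_obj card12 M) vA.
have orF : orep (functor_obj rho b A) = rho (orep A).
  by rewrite /functor_obj orep_rcoset (om_rep M S_rep).1.
have [|-> mapE] := functor_rep M' (x := b (orep A) (orep_elt A)) vFA.
  by rewrite orF.
have A1 : 1 \in A by case/andP: vA.
rewrite orF rhoK // bK //; last by rewrite -[orep_elt A]mul1g -mem_orep_elt.
rewrite -orep_eltP; split=> // g gA.
rewrite mapE orF /functor_map mulgKV !bK ?mulgK -?mem_orep_elt //.
by rewrite -[orep_elt A]mul1g -mem_orep_elt.
Qed.

(** The orbits are matched according to the size of their members and the order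
of the stabilizer. By the isomorphism of subgroup lattices there are equally
many orbits of each type, and by the last hypothesis the stabilizers of matched
orbits are isomorphic. *)
Theorem exists_vertex_functor (gT1 gT2 : finGroupType)
    (phi : {group gT1} -> {group gT2}) (phi' : {group gT2} -> {group gT1}) :
  #|gT1| = #|gT2| -> cancel phi phi' -> cancel phi' phi ->
  (forall H, #|phi H| = #|H|) ->
  (forall H B, (phi H \subset phi B) = (H \subset B)) ->
  (forall (H1 : {group gT1}) (H2 : {group gT2}),
     #|H1| = #|H2| -> H1 != [set: gT1]%G -> H1 \isog H2) ->
  exists Fo F Fo' F', [/\ @vertex_functor gT1 gT2 Fo F, @vertex_functor gT2 gT1 Fo' F',
    inverse_functor Fo F Fo' F' & inverse_functor Fo' F' Fo F].
Proof.
move=> card12 phiK phi'K card_phi phiS isoP.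
pose key (gT : finGroupType) (S : {set gT}) := (#|stab S|, #|S|).
have full_card (gT : finGroupType) (H : {group gT}) : (H == [set: gT]%G) = (#|H| == #|gT|).
  apply/eqP/eqP => [->|HT]; first exact: cardsT.
  by apply/val_inj/eqP; rewrite eqEcard subsetT /= cardsT HT.
have key_reps (gT : finGroupType) z :
    [set S in vertex_reps gT | key gT S == z] =
    if z.1 == #|gT| then set0 else oreps gT z.1 z.2.
  case: z => h k /=; apply/setP=> S; rewrite /key !inE full_card -pair_eqE /=.
  have [->|hT] := eqVneq h #|gT|.
    by rewrite inE; apply/negP=> /and3P[/andP[_ /negPf->]].
  rewrite inE; case: (orep S == S) => //=.
  by have [->|_] := eqVneq #|stab S| h; rewrite ?hT ?andbF.
have [z|rho [rho' [rhoP rho'P]]] := @key_bijection _ _ _ set0 set0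
    (vertex_reps gT1) (vertex_reps gT2) (key gT1) (key gT2).
  rewrite !key_reps -card12; case: ifP => // _; first by rewrite !cards0.
  apply/eqP; rewrite -(eqn_pmul2r (cardG_gt0 [set: gT1]%G)) cardsT -card_oreps.
  by rewrite (nb_type_eq card12 phiK phi'K card_phi phiS) card_oreps -card12.
have /fin_all_exists[d dP] : forall S : {set gT1}, exists d :
    ((gT1 -> gT2) * (gT2 -> gT1)) * ((gT1 -> gT2) * (gT2 -> gT1)),
    S \in vertex_reps gT1 ->
    [/\ forall x, x \in S -> d.1.1 x \in rho S /\ d.1.2 (d.1.1 x) = x,
      forall x, x \in rho S -> d.1.2 x \in S /\ d.1.1 (d.1.2 x) = x,
      forall x h, h \in stab S -> d.2.1 h \in stab (rho S) /\
         d.1.1 (x * h) = d.1.1 x * d.2.1 h &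
      forall x h, h \in stab (rho S) -> d.2.2 h \in stab S /\
         d.1.2 (x * h) = d.1.2 x * d.2.2 h].
  move=> S; have [SR|_] := boolP (S \in vertex_reps gT1); last first.
    by exists ((fun=> 1, fun=> 1), (fun=> 1, fun=> 1)).
  have [_ [stS cS] _] := rhoP S SR.
  have iso : stab S \isog stab (rho S).
    by apply: isoP => //; move: SR; rewrite inE => /andP[].
  have [b [b' [i [i' bP]]]] :=
    equivariant_bijection iso (subxx _) (subxx _) (esym cS).
  by exists ((b, b'), (i, i')).
(* The inverse data at S come from the representative rho' S that is sent to S. *)
pose b S := (d S).1.1; pose i S := (d S).2.1.
pose b' S := (d (rho' S)).1.2; pose i' S := (d (rho' S)).2.2.
have rep (gT : finGroupType) (S : {set gT}) : S \in vertex_reps gT -> orep S = S.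
  by rewrite inE => /andP[/eqP].
have M : orbit_matching rho b i.
  split=> S; first by move=> /rhoP[/rep rS [_ cS] _].
  - by move=> x /dP[bin _ _ _] /bin[].
  - by move=> h /dP[_ _ bM _] /(bM 1)[].
  - by move=> x h /dP[_ _ bM _] /(bM x)[].
have M' : orbit_matching rho' b' i'.
  split=> S; first by move=> /rho'P[/rep rS [_ cS] _].
  - by move=> x /rho'P[/dP[_ b'in _ _] _ e] xS; have [] := b'in x; rewrite ?e.
  - by move=> h /rho'P[/dP[_ _ _ bM] _ e] hS; have [] := bM 1 h; rewrite ?e.
  - by move=> x h /rho'P[/dP[_ _ _ bM] _ e] hS; have [] := bM x h; rewrite ?e.
exists (functor_obj rho b), (functor_map b), (functor_obj rho' b'), (functor_map b').
split.
- exact: (vertex_functor_obj card12 M).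
- exact: (vertex_functor_obj (esym card12) M').
- apply: (inverse_functor_obj card12 M M') => [S /rhoP[] //|S x SR xS].
  have [_ _ e] := rhoP S SR; rewrite /b' e.
  by have [bin _ _ _] := dP S SR; have [] := bin x xS.
- apply: (inverse_functor_obj (esym card12) M' M) => [S /rho'P[] //|S x SR xS].
  have [SR' _ e] := rho'P S SR.
  by have [_ b'in _ _] := dP _ SR'; have [] := b'in x; rewrite ?e.
Qed.

Local Close Scope group_scope.
Local Open Scope ring_scope.

(** * The groups of order 605 and their presentations *)

Lemma pow5D (m : 'F_11) (i j : 'Z_5) :
  m ^+ 5 = 1 -> m ^+ (i + j : 'Z_5)%R = m ^+ i * m ^+ j.
Proof. by move=> m5; rewrite -exprD -[RHS](expr_mod _ m5). Qed.

(** An element of order 5 in the multiplicative group of F_11; its powers are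
1, 3, 9, 5, 4. *)
Definition three : 'F_11 := 3%:R.

Lemma three_pow5 r : (three ^+ r) ^+ 5 = 1.
Proof. by rewrite exprAC (_ : three ^+ 5 = 1) ?expr1n //; apply/val_inj. Qed.

(** The triple (i, (x, y)) stands for c^i a^x b^y, where conjugation by c raises a
to the power 3 and b to the power 3^r. As 3^2 = 9 and 3^4 = 4 modulo 11, the two
groups of interest are aff 2 and aff 4. *)
Definition aff (r : nat) : Type := ('Z_5 * ('F_11 * 'F_11))%type.

Section Aff.
Variable r : nat.
HB.instance Definition _ := Finite.on (aff r).

Definition twist (j : 'Z_5) (v : 'F_11 * 'F_11) : 'F_11 * 'F_11 :=
  (three ^+ j * v.1, (three ^+ r) ^+ j * v.2).

Lemma twistD i j v : twist (i + j) v = twist i (twist j v).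
Proof.
rewrite /twist /= !pow5D ?three_pow5 ?mulrA //.
exact: (three_pow5 1).
Qed.

Lemma twist0 v : twist 0 v = v.
Proof. by case: v => x y; rewrite /twist /= !expr0 !mul1r. Qed.

Lemma twist_add j : {morph twist j : u v / u + v}.
Proof. by move=> u v; rewrite /twist /= !mulrDr. Qed.

Definition aff_mul (g h : aff r) : aff r := (g.1 + h.1, twist h.1 g.2 + h.2).
Definition aff_one : aff r := (0, 0).
Definition aff_inv (g : aff r) : aff r := (- g.1, twist (- g.1) (- g.2)).

Lemma aff_mulA : associative aff_mul.
Proof.
move=> [i u] [j v] [k w]; congr (_, _); rewrite /= ?addrA //.
by rewrite twist_add -twistD [k + j]addrC.
Qed.

Lemma aff_mul1 : left_id aff_one aff_mul.
Proof.
move=> [i u]; congr (_, _) => /=; rewrite ?add0r //.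
by rewrite /twist /= !mulr0 -[RHS]add0r.
Qed.

Lemma aff_mulV : left_inverse aff_one aff_inv aff_mul.
Proof.
move=> [i u]; congr (_, _) => /=; rewrite ?addNr //.
by rewrite -twistD subrr twist0 addNr.
Qed.

HB.instance Definition _ := Finite_isGroup.Build (aff r)
  aff_mulA aff_mul1 aff_mulV.

Lemma affM (g h : aff r) : (g * h)%g = (g.1 + h.1, twist h.1 g.2 + h.2) :> aff r.
Proof. by []. Qed.

Lemma aff1 : 1%g = (0, 0) :> aff r.
Proof. by []. Qed.

Lemma affV (g : aff r) : (g^-1)%g = (- g.1, twist (- g.1) (- g.2)) :> aff r.
Proof. by []. Qed.

Lemma card_aff : #|{: aff r}| = 605%N.
Proof. by rewrite !card_prod !card_ord. Qed.

End Aff.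

Lemma aff_mulE r (i j : 'Z_5) (x y x' y' : 'F_11) :
  (((i, (x, y)) : aff r) * ((j, (x', y')) : aff r))%g =
  (i + j, (three ^+ j * x + x', (three ^+ r) ^+ j * y + y')) :> aff r.
Proof. by []. Qed.

Section AffRelations.
Variables (r : nat) (H : groupType) (a b c : H).
Hypotheses (a11 : (a ^+ 11 = 1)%g) (b11 : (b ^+ 11 = 1)%g) (c5 : (c ^+ 5 = 1)%g).
Hypotheses (ab : commute a b).
Hypotheses (ac : (a ^ c = a ^+ 3)%g) (bc : (b ^ c = b ^+ (three ^+ r : 'F_11)%R)%g).

(** The normal form c^i a^x b^y, in any group where the relations hold. *)
Definition aff_word (g : aff r) : H := (c ^+ g.1 * (a ^+ g.2.1 * b ^+ g.2.2))%g.

Lemma aff_wordP i x y : aff_word (i, (x, y)) = (c ^+ i * (a ^+ x * b ^+ y))%g.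
Proof. by []. Qed.

Lemma expg_modn (x : H) d n : (x ^+ d = 1)%g -> (x ^+ (n %% d) = x ^+ n)%g.
Proof.
by move=> xd; rewrite [in RHS](divn_eq n d) expgnDr mulnC expgnA xd expg1n mul1g.
Qed.

Lemma expg_conj (x : H) (m : 'F_11) (j : nat) : (x ^+ 11 = 1)%g -> (x ^ c = x ^+ m)%g ->
  forall y : 'F_11, ((x ^+ y) ^ (c ^+ j) = x ^+ (m ^+ j * y)%R)%g.
Proof.
move=> x11 xc; elim: j => [|j IHj] y.
  by rewrite expg0 conjg1 expr0 mul1r.
rewrite expgSr conjgM IHj conjXg xc -expgnA exprS -mulrA.
by rewrite -[LHS](expg_modn _ x11).
Qed.

Lemma aff_wordM g h : aff_word (g * h)%g = (aff_word g * aff_word h)%g.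
Proof.
case: g h => i [x y] [j [x' y']]; rewrite aff_mulE !aff_wordP.
rewrite [in RHS]mulgA -[(c ^+ i * _ * _)%g]mulgA [(_ * c ^+ j)%g]conjgC.
rewrite conjMg (expg_conj _ a11 (m := three)) ?(expg_conj _ b11 bc) //.
have cD : (c ^+ (i + j : 'Z_5)%R = c ^+ i * c ^+ j)%g.
  by rewrite -expgnDr -[RHS](expg_modn _ c5).
have pD (p : H) (u v : 'F_11) : (p ^+ 11 = 1 -> p ^+ (u + v)%R = p ^+ u * p ^+ v)%g.
  by move=> p11; rewrite -expgnDr -[RHS](expg_modn _ p11).
rewrite cD !pD // -!mulgA; congr (_ * (_ * (_ * _)))%g.
by rewrite !mulgA; congr (_ * _)%g; apply/commute_sym/commuteX2.
Qed.

End AffRelations.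

Section AffGenerators.
Variable r : nat.
Definition aff_a : aff r := (0, (1, 0)).
Definition aff_b : aff r := (0, (0, 1)).
Definition aff_c : aff r := (1, (0, 0)).

Lemma aff_V (u v : 'F_11 * 'F_11) : (((0, u) : aff r) * ((0, v) : aff r))%g = (0, u + v).
Proof. by rewrite affM /= twist0 addr0. Qed.

Lemma aff_VX (u : 'F_11 * 'F_11) n : (((0, u) : aff r) ^+ n)%g = (0, u *+ n).
Proof. by elim: n => // n IHn; rewrite expgS IHn aff_V mulrS. Qed.

Lemma aff_cX n : (aff_c ^+ n)%g = (n%:R, (0, 0)) :> aff r.
Proof.
elim: n => // n IHn; rewrite expgS IHn affM /= -mulrS.
by rewrite /twist /= !mulr0 addr0.
Qed.

Lemma pairMn (x y : 'F_11) n : (x, y) *+ n = (x *+ n, y *+ n).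
Proof. by elim: n => // n IHn; rewrite !mulrS IHn. Qed.

Lemma aff_conj (g : aff r) (u : 'F_11 * 'F_11) :
  (((0, u) : aff r) ^ g)%g = (0, twist r g.1 u).
Proof.
case: g => i v; apply: (mulgI ((i, v) : aff r)); rewrite -conjgC !affM /=.
by rewrite twist0 add0r addr0 addrC.
Qed.

Lemma aff_a11 : (aff_a ^+ 11)%g = 1%g.
Proof. by rewrite aff_VX pairMn; apply/eqP. Qed.
Lemma aff_b11 : (aff_b ^+ 11)%g = 1%g.
Proof. by rewrite aff_VX pairMn; apply/eqP. Qed.
Lemma aff_c5 : (aff_c ^+ 5)%g = 1%g.
Proof. by rewrite aff_cX; apply/eqP. Qed.
Lemma aff_ab : commute aff_a aff_b.
Proof. by rewrite /commute !aff_V addrC. Qed.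
Lemma aff_ac : (aff_a ^ aff_c)%g = (aff_a ^+ 3)%g.
Proof. by rewrite aff_conj aff_VX pairMn /twist /= mulr0 mulr1 expr1 mul0rn. Qed.
Lemma aff_bc : (aff_b ^ aff_c)%g = (aff_b ^+ (three ^+ r : 'F_11)%R)%g.
Proof.
rewrite aff_conj aff_VX pairMn /twist /= mulr0 mulr1 !expr1 mul0rn.
by rewrite natr_Zp.
Qed.

Lemma aff_wordE g : aff_word aff_a aff_b aff_c g = g.
Proof.
case: g => i [x y]; rewrite aff_wordP aff_cX !aff_VX !pairMn !mul0rn.
rewrite !natr_Zp aff_V (_ : (x, 0) + (0, y) = (x, y)); last first.
  by rewrite /GRing.add /=; congr (_, _); rewrite ?addr0 ?add0r.
by rewrite aff_mulE !mulr0 !add0r addr0.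
Qed.
End AffGenerators.

Section Presentation.
Variables (r k : nat).
Hypothesis kr : k = (three ^+ r : 'F_11)%R :> nat.
Local Notation P := (pres_group (rels605 k)).
Let pa : P := pres_gen _ (inord 0).
Let pb : P := pres_gen _ (inord 1).
Let pc : P := pres_gen _ (inord 2).

Lemma pres_pi_cat (I : choiceType) (R : seq (word I * word I)) u v :
  pres_pi R (u ++ v) = (pres_pi R u * pres_pi R v)%g.
Proof. by rewrite -[RHS]/(pres_mul _ _) pres_mul_pi. Qed.

Lemma pres_pi_wexp (I : choiceType) (R : seq (word I * word I)) u n :
  pres_pi R (wexp u n) = (pres_pi R u ^+ n)%g.
Proof. by elim: n => // n IHn; rewrite expgS -IHn -pres_pi_cat. Qed.

Lemma pres_pi_winv (I : choiceType) (R : seq (word I * word I)) u :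
  pres_pi R (winv u) = (pres_pi R u)^-1%g.
Proof. by rewrite -[RHS]/(pres_inv _) pres_inv_pi. Qed.

Lemma pres_relation (I : choiceType) (R : seq (word I * word I)) u v :
  (u, v) \in R -> pres_pi R u = pres_pi R v.
Proof. by move=> uv; apply/pres_piP; exact: weqv_rel. Qed.

(** The presentation maps onto aff r because the standard generators of aff r
satisfy the relations. Conversely the normal form is multiplicative, hence a
morphism back, and the two morphisms are inverse because they are so on the
generators. *)
Lemma pres_aff_iso : exists f : {multiplicative P -> aff r}, bijective f.
Proof.
pose R := rels605 k; pose rho n := nth ([::], [::]) R n.
have rel n : (n < 6)%N -> pres_pi R (rho n).1 = pres_pi R (rho n).2.
  by move=> n6; apply: pres_relation; rewrite -surjective_pairing; exact: mem_nth.
have a11 : (pa ^+ 11 = 1)%g by rewrite -pres_pi_wexp; exact: (rel 0%N isT).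
have b11 : (pb ^+ 11 = 1)%g by rewrite -pres_pi_wexp; exact: (rel 1%N isT).
have c5 : (pc ^+ 5 = 1)%g by rewrite -pres_pi_wexp; exact: (rel 2%N isT).
have ab : commute pa pb by rewrite /commute -!pres_pi_cat; exact: (rel 3%N isT).
have conj_pi i j : (pres_gen R i ^ pres_gen R j)%g =
    pres_pi R (winv (wgen j) ++ wgen i ++ wgen j).
  by rewrite !pres_pi_cat pres_pi_winv.
have ac : (pa ^ pc = pa ^+ 3)%g.
  by rewrite conj_pi -pres_pi_wexp; exact: (rel 4%N isT).
have bc : (pb ^ pc = pb ^+ (three ^+ r : 'F_11)%R)%g.
  by rewrite -kr conj_pi -pres_pi_wexp; exact: (rel 5%N isT).
pose h (i : 'I_3) := nth 1%g [:: aff_a r; aff_b r; aff_c r] i.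
have h0 : h (inord 0) = aff_a r by rewrite /h inordK.
have h1 : h (inord 1) = aff_b r by rewrite /h inordK.
have h2 : h (inord 2) = aff_c r by rewrite /h inordK.
have ev_cat u v : weval h (u ++ v) = (weval h u * weval h v)%g.
  by rewrite /weval big_cat.
have ev_gen i : weval h (wgen i) = h i by rewrite /weval big_seq1.
have ev_inv i : weval h (winv (wgen i)) = (h i)^-1%g by rewrite /weval big_seq1.
have ev_exp i n : weval h (wexp (wgen i) n) = (h i ^+ n)%g.
  elim: n => [|n IHn]; first by rewrite /weval big_nil.
  by rewrite expgS -IHn -[in RHS]ev_gen -ev_cat.
have ev_ab : weval h (wgen (inord 0) ++ wgen (inord 1)) =
             weval h (wgen (inord 1) ++ wgen (inord 0)).
  by rewrite !ev_cat !ev_gen h0 h1; exact: aff_ab.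
have ev_conj i j n : (h i ^ h j = h i ^+ n)%g ->
    weval h (winv (wgen j) ++ wgen i ++ wgen j) = weval h (wexp (wgen i) n).
  by rewrite !ev_cat ev_inv ev_exp !ev_gen.
have hR u v : (u, v) \in rels605 k -> weval h u = weval h v.
  rewrite !inE => /or4P[|||/or3P[]] /eqP[-> ->].
  - by rewrite [LHS]ev_exp h0 aff_a11 /weval big_nil.
  - by rewrite [LHS]ev_exp h1 aff_b11 /weval big_nil.
  - by rewrite [LHS]ev_exp h2 aff_c5 /weval big_nil.
  - exact: ev_ab.
  - by apply: ev_conj; rewrite h0 h2 aff_ac.
  - by apply: ev_conj; rewrite h1 h2 kr aff_bc.
have [f [fg _]] := pres_groupP hR.
pose s := aff_word pa pb pc : aff r -> P.
pose sm := isMultiplicative.Build (aff r) P s (aff_wordM a11 b11 c5 ab ac bc).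
pose s' : {multiplicative aff r -> P} := HB.pack s sm.
have fa : f pa = aff_a r by rewrite -h0; exact: fg.
have fb : f pb = aff_b r by rewrite -h1; exact: fg.
have fc : f pc = aff_c r by rewrite -h2; exact: fg.
exists f, s => x; last first.
  by rewrite /s /aff_word !gmulfM !multiplicativeX fa fb fc; exact: aff_wordE.
have evP w : weval (pres_gen (rels605 k)) w = pres_pi (rels605 k) w.
  elim: w => [|[i d] w IHw]; first by rewrite /weval big_nil.
  rewrite -cat1s pres_pi_cat -IHw /weval big_cons; congr (_ * _)%g.
  by case: d => //=; rewrite -[(_, true) :: _]/(winv (wgen i)) pres_pi_winv.
have [e [_ e_uniq]] := @pres_groupP _ (rels605 k) P (pres_gen _)
   (fun u v uv => etrans (evP u) (etrans (pres_relation uv) (esym (evP v)))).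
have s_a : s (aff_a r) = pa by rewrite /s /aff_word /= mul1g mulg1.
have s_b : s (aff_b r) = pb by rewrite /s /aff_word /= !mul1g.
have s_c : s (aff_c r) = pc by rewrite /s /aff_word /= !mulg1.
have gens (i : 'I_3) : [\/ i = inord 0, i = inord 1 | i = inord 2].
  case: i => -[|[|[|//]]] i3; [apply: Or31|apply: Or32|apply: Or33];
    by apply: val_inj; rewrite /= inordK.
rewrite -[LHS]/((s' \o f) x) (e_uniq (s' \o f)) => [|i].
  by rewrite -(e_uniq idfun).
by rewrite /=; case: (gens i) => ->; rewrite ?fa ?fb ?fc.
Qed.
End Presentation.

Lemma aff_fstX r (g : aff r) n : (g ^+ n)%g.1 = g.1 *+ n.
Proof. by elim: n => // n IHn; rewrite expgS affM /= IHn mulrS. Qed.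

Lemma aff_order11 r (g : aff r) : (g ^+ 11)%g = 1%g -> g = (0, g.2).
Proof.
case: g => i u g11; congr (_, _); have := aff_fstX ((i, u) : aff r) 11.
rewrite g11 => /esym /=; case: i {g11} => -[|[|[|[|[|//]]]]] i5 /eqP // _.
exact: val_inj.
Qed.

Lemma twist_eigen r j (u : 'F_11 * 'F_11) m : u != 0 -> twist r j u = u *+ m ->
  (three ^+ j == m%:R) || ((three ^+ r) ^+ j == m%:R).
Proof.
case: u => x y; rewrite pairMn /twist /= => nz [Ex Ey].
have [x0|/mulIf inj] := eqVneq x 0.
  have /mulIf inj : y != 0 by apply: contraNneq nz => ->; rewrite x0.
  by apply/orP; right; apply/eqP/inj; rewrite Ey mulr_natl.
by apply/orP; left; apply/eqP/inj; rewrite Ex mulr_natl.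
Qed.

(** The elements of order 11 lie in F_11^2, so f maps a and b to eigenvectors of
f(c), with eigenvalues 3 and 9. If f(c) acts as diag(3^j, 4^j), then 3 forces
j = 1 or 4 and 9 forces j = 2 or 3. *)
Lemma aff_not_iso : ~ exists f : {multiplicative aff 2 -> aff 4}, bijective f.
Proof.
case=> f /bij_inj f_inj.
pose j := (f (aff_c 2)).1.
have eigen (x : aff 2) m : x != 1%g -> (x ^+ 11)%g = 1%g -> (x ^ aff_c 2 = x ^+ m)%g ->
    (three ^+ j == m%:R) || ((three ^+ 4) ^+ j == m%:R).
  move=> x1 x11 xc; have fx : f x = (0, (f x).2).
    by apply: aff_order11; rewrite -multiplicativeX x11 multiplicative1.
  apply: (@twist_eigen 4 j (f x).2).
    by apply: contraNneq x1 => fx0; apply/eqP/f_inj; rewrite multiplicative1 fx fx0.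
  have : f (x ^ aff_c 2)%g = (f x ^+ m)%g by rewrite xc multiplicativeX.
  by rewrite multiplicativeJ fx aff_conj aff_VX => -[].
have ja := eigen (aff_a 2) 3 isT (aff_a11 2) (aff_ac 2).
have jb := eigen (aff_b 2) 9 isT (aff_b11 2) (aff_bc 2).
have : ~~ (((three ^+ j == 3%:R) || ((three ^+ 4) ^+ j == 3%:R)) &&
           ((three ^+ j == 9%:R) || ((three ^+ 4) ^+ j == 9%:R))).
  by case: (j) => -[|[|[|[|[|m]]]]] // lt5; vm_compute.
by rewrite ja jb.
Qed.

(** * Subgroups of the two groups *)

(** Reduces a statement on Z/n to a computation. *)
Lemma Zp_check n (P : 'Z_n.+2 -> bool) :
  all (fun k => P (inZp k)) (iota 0 n.+2) -> forall i, P i.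
Proof.
by move=> /allP all_P i; have := all_P i; rewrite valZpK mem_iota /= add0n ltn_ord; apply.
Qed.

(** The hypotheses say that the linear form (c, d) is a multiple of (a, b). *)
Lemma proportional_eq0 (F : fieldType) (a b c d x y : F) :
  a * d = b * c -> (a == 0) && (b == 0) ==> (c == 0) && (d == 0) ->
  a * x + b * y = 0 -> c * x + d * y = 0.
Proof.
move=> adbc; have [az|a0] := eqVneq a 0; last first.
  move=> _ e; apply: (mulfI a0); rewrite mulr0 mulrDr !mulrA adbc.
  by rewrite [a * c]mulrC [b * c]mulrC -!mulrA -mulrDr e mulr0.
move: adbc; rewrite {}az; have [->|b0] /= := eqVneq b 0.
  by move=> _ /andP[/eqP-> /eqP->]; rewrite !mul0r addr0.
rewrite mul0r => bc0 _; have -> : c = 0 by apply: (mulfI b0); rewrite -bc0 mulr0.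
rewrite !mul0r !add0r => by0; have -> : y = 0 by apply: (mulfI b0); rewrite by0 mulr0.
by rewrite mulr0.
Qed.

(** The sum 1 + m + ... + m^(i-1), in Horner form, except that it is set to 1 for
i = 0 in order to be invertible everywhere. For u in the eigenline of m,
(c u)^i = c^i u^(geom m i). *)
Definition geom (m : 'F_11) (i : 'Z_5) : 'F_11 :=
  if i == 0 then 1 else iter i (fun s => 1 + m * s) 0.

Definition rescale r r' (i : 'Z_5) : 'F_11 :=
  geom (three ^+ r') i / geom (three ^+ r) i.

(** An element outside F_11^2 is (c u)^i for a unique i != 0 and a unique u in
F_11^2; theta maps it to (c u)^i computed in the other group. On F_11^2 it is the
identity. *)
Definition theta (r r' : nat) (g : aff r) : aff r' :=
  (g.1, (g.2.1, rescale r r' g.1 * g.2.2)).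

Definition opposite_twists (r r' : nat) := (r == 2%N) && (r' == 4%N) || (r == 4%N) && (r' == 2%N).

Lemma geom_neq0 r i : (r == 2%N) || (r == 4%N) -> geom (three ^+ r) i != 0.
Proof.
move=> rr; move: i; apply: (@Zp_check 3 (fun i => geom (three ^+ r) i != 0)).
by case/orP: rr => /eqP->; vm_compute.
Qed.

(** With k, k' and l as below, a y + b y' is the b-coordinate of the commutator of
(i, (x, y)) and (j, (x', y')), and c y + d y' measures the failure of theta to be
multiplicative on these two elements. The test says that the second form is a
multiple of the first one. *)
Definition rescale_proportional r r' (i j : 'Z_5) : bool :=
  let k := three ^+ r in let k' := three ^+ r' in let l := rescale r r' in
  let a := k ^+ j - 1 in let b := 1 - k ^+ i in
  let c := l (i + j) * k ^+ j - k' ^+ j * l i in let d := l (i + j) - l j in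
  (a * d == b * c) && ((a == 0) && (b == 0) ==> (c == 0) && (d == 0)).

Lemma opposite_rescale r r' : opposite_twists r r' ->
  forall i j, rescale_proportional r r' i j.
Proof.
move=> rr i j; move: i; apply: (@Zp_check 3 (fun i => rescale_proportional r r' i j)).
move: j; apply: (@Zp_check 3 (fun j => all (fun i =>
  rescale_proportional r r' (inZp i) j) (iota 0 5))).
by case/orP: rr => /andP[/eqP-> /eqP->]; vm_compute.
Qed.

Lemma eigen_neq r (i : 'Z_5) : (r == 2%N) || (r == 4%N) -> i != 0 ->
  (three ^+ r) ^+ i != three ^+ i.
Proof.
move=> rr; move: i.
suff : forall i : 'Z_5, (i != 0) ==> ((three ^+ r) ^+ i != three ^+ i).
  by move=> neq i; apply/implyP.
apply: (@Zp_check 3 (fun i => (i != 0) ==> ((three ^+ r) ^+ i != three ^+ i))).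
by case/orP: rr => /eqP->; vm_compute.
Qed.

Lemma pairB (x y x' y' : 'F_11) : (x, y) - (x', y') = (x - x', y - y').
Proof. by []. Qed.

(** Conjugation by g multiplies the two coordinates of (p, q) by different
scalars, so a combination of (p, q) and its conjugate kills p but not q. *)
Lemma vert_in_group r (H : {group aff r}) (p q e : 'F_11) (g : aff r) :
  (r == 2%N) || (r == 4%N) -> q != 0 -> g.1 != 0 ->
  ((0, (p, q)) : aff r) \in H -> g \in H -> ((0, (0, e)) : aff r) \in H.
Proof.
move=> rr q0 g0 wH gH; pose s := ((three ^+ r) ^+ g.1 - three ^+ g.1) * q.
have s0 : s != 0 by rewrite mulf_neq0 // subr_eq0 eigen_neq.
have sH : ((0, (0, s)) : aff r) \in H.
  rewrite (_ : (0, (0, s)) = (((0, (p, q)) : aff r) ^ g *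
             (((0, (p, q)) : aff r) ^+ (three ^+ g.1 : 'F_11)%R)^-1)%g :> aff r).
    by rewrite groupM ?groupV ?groupX ?groupJ.
  rewrite aff_conj aff_VX affV oppr0 twist0 aff_V pairMn pairB.
  by rewrite -(mulr_natr p) -(mulr_natr q) !natr_Zp [p * _]mulrC [q * _]mulrC subrr -mulrBl.
have -> : (0, (0, e)) = (((0, (0, s)) : aff r) ^+ (e / s : 'F_11)%R)%g :> aff r.
  by rewrite aff_VX pairMn mul0rn -mulr_natr natr_Zp mulrC divfK.
exact: groupX.
Qed.

Lemma commutator_coord (R : comNzRingType) (s t x x' : R) :
  (s * x' + x) + ((t - 1) * x + (1 - s) * x') = t * x + x'.
Proof. by ring. Qed.

Lemma rescale_coord (R : comNzRingType) (m li lj s t y y' : R) :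
  m * (s * y + y') - ((m * s - t * li) * y + (m - lj) * y') = t * (li * y) + lj * y'.
Proof. by ring. Qed.

Section Theta.
Variables r r' : nat.
Hypothesis rr' : opposite_twists r r'.

Let twist_cases : ((r == 2%N) || (r == 4%N)) && ((r' == 2%N) || (r' == 4%N)).
Proof. by case/orP: rr' => /andP[/eqP-> /eqP->]. Qed.

Lemma thetaK : cancel (@theta r r') (@theta r' r).
Proof.
case=> i [x y]; rewrite /theta /rescale /= mulrA mulrA.
case/andP: twist_cases => ? ?.
by rewrite mulfVK ?divff ?mul1r ?geom_neq0.
Qed.

(** The product of theta g and theta h is the image of g h b^-e for some e. If the
commutator of g and h has trivial b-coordinate, then e = 0. Otherwise g or h lies
outside F_11^2, and the subgroup contains the whole axis of b. *)
Lemma theta_group (H : {group aff r}) : group_set (@theta r r' @: H).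
Proof.
apply/group_setP; split=> [|_ _ /imsetP[g gH ->] /imsetP[h hH ->]].
  apply/imsetP; exists 1%g; rewrite ?group1 //.
  by rewrite aff1 /theta /= mulr0.
case: g h gH hH => i [x y] [j [x' y']] gH hH.
have /andP[rr _] := twist_cases; set k := three ^+ r; set k' := three ^+ r'; pose l := rescale r r'.
pose c := l (i + j) * k ^+ j - k' ^+ j * l i; pose d := l (i + j) - l j.
pose p := (three ^+ j - 1) * x + (1 - three ^+ i) * x'.
pose q := (k ^+ j - 1) * y + (1 - k ^+ i) * y'.
have lij : l (i + j) != 0.
  by case/andP: twist_cases => ? ?; rewrite mulf_neq0 ?invr_eq0 ?geom_neq0.
pose e := (c * y + d * y') / l (i + j).
have eH : ((0, (0, - e)) : aff r) \in H.
  have pqH : ((0, (p, q)) : aff r) \in H.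
    pose g : aff r := (i, (x, y)); pose h : aff r := (j, (x', y')).
    rewrite (_ : (0, (p, q)) = [~ g, h]%g) ?groupR //.
    apply: (mulgI (h * g)%g); rewrite -commgC [LHS]affM twist0 addr0.
    by congr (_, (_, _)) => /=; rewrite ?commutator_coord // addrC.
  have [q0|q0] := eqVneq q 0.
    have /andP[/eqP ad ab] := opposite_rescale rr' i j.
    by rewrite /e (proportional_eq0 ad ab q0) mul0r oppr0 group1.
  have [i0|i0] := eqVneq i 0; last first.
    exact: (@vert_in_group r H p q _ (i, (x, y)) rr q0 i0 pqH gH).
  have [j0|j0] := eqVneq j 0; last first.
    exact: (@vert_in_group r H p q _ (j, (x', y')) rr q0 j0 pqH hH).
  by move: q0; rewrite /q i0 j0 !expr0 subrr !mul0r addr0 eqxx.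
apply/imsetP; exists (((i, (x, y)) : aff r) * ((j, (x', y')) : aff r) * ((0, (0, - e)) : aff r))%g.
  by rewrite !groupM.
rewrite [in RHS]affM twist0 /theta addr0 /=; congr (_, (_, _)) => /=.
  by rewrite addr0.
have el : l (i + j) * e = c * y + d * y' by rewrite /e mulrC divfK.
by rewrite -/l mulrBr el /c /d -/k -/k' rescale_coord.
Qed.

Definition theta_grp (H : {group aff r}) : {group aff r'} := Group (theta_group H).

Lemma card_theta_grp H : #|theta_grp H| = #|H|.
Proof. by rewrite /= card_imset //; exact: can_inj thetaK. Qed.

Lemma theta_grpS H B : (theta_grp H \subset theta_grp B) = (H \subset B).
Proof.
apply/idP/idP => [/subsetP HB|]; last exact: imsetS.
apply/subsetP=> g gH; have /imsetP[b bB e] := HB _ (imset_f _ gH).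
by rewrite (can_inj thetaK e).
Qed.

End Theta.

Lemma theta_grpK r r' (rr' : opposite_twists r r') (r'r : opposite_twists r' r) :
  cancel (theta_grp rr') (theta_grp r'r).
Proof.
move=> H; apply/val_inj/setP=> g /=; rewrite -imset_comp.
rewrite (eq_imset _ (g := id)) ?imset_id // => x /=.
exact: thetaK.
Qed.

Local Close Scope ring_scope.
Local Open Scope group_scope.

(** The normal subgroup F_11^2. *)
Definition translations r : {set aff r} := [set g | g.1 == 0%R].

Lemma translations_group r : group_set (translations r).
Proof.
apply/group_setP; split=> [|g h]; rewrite !inE // => /eqP g0 /eqP h0.
by rewrite /= g0 h0 addr0.
Qed.
Canonical translations_grp r := Group (translations_group r).

Lemma translationsP r (g : aff r) : reflect (g ^+ 11 = 1) (g \in translations r).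
Proof.
rewrite inE; apply: (iffP eqP) => [|/aff_order11-> //].
case: g => i [x y] /= ->; rewrite aff_VX pairMn.
have p0 (z : 'F_11) : (z *+ 11 = 0)%R by rewrite -mulr_natr [(11%:R)%R](_ : _ = 0%R) ?mulr0 //; exact/val_inj.
by rewrite !p0.
Qed.

Lemma translations_abelem r (H : {group aff r}) :
  H \subset translations r -> 11.-abelem H.
Proof.
move=> HV; apply/abelemP => //; split; last by move=> g /(subsetP HV)/translationsP.
apply/centsP=> g /(subsetP HV); rewrite inE => /eqP g0 h /(subsetP HV).
rewrite inE => /eqP h0; rewrite /commute !affM g0 h0 !twist0.
by rewrite [(g.2 + _)%R]addrC.
Qed.

(** The subgroup generated by a and c, as a model of the nonabelian group of order
55. *)
Definition line : {set aff 0} := [set g | g.2.2 == 0%R].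

Lemma line_group : group_set line.
Proof.
apply/group_setP; split=> [|g h]; rewrite !inE // => /eqP g0 /eqP h0.
by rewrite affM /= g0 h0 mulr0 addr0.
Qed.
Canonical line_grp := Group line_group.

Lemma card_line : #|line| = 55.
Proof.
have -> : line = [set ((u.1, (u.2, 0%R)) : aff 0) | u : 'Z_5 * 'F_11].
  apply/setP=> -[i [x y]]; rewrite inE /=; apply/eqP/imsetP => [->|[[j z] _]].
    by exists (i, x).
  by case.
by rewrite card_imset ?card_prod ?card_ord // => -[i x] [j y] [-> ->].
Qed.

(** The normal form y^i x^n is a morphism from the model. It is injective: if
y^i x^n = 1, then y^i commutes with x, so 3^i = 1 and i = 0. *)
Lemma isog_line (gT : finGroupType) (H : {group gT}) x y :
  #|H| = 55 -> x \in H -> y \in H -> x != 1 -> x ^+ 11 = 1 -> y ^+ 5 = 1 ->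
  x ^ y = x ^+ 3 -> H \isog line.
Proof.
move=> H55 xH yH x1 x11 y5 xy.
have wM := @aff_wordM 0 gT x 1 y x11 (expg1n _ 11) y5 (commute1 x) xy.
have {}wM := wM (etrans (conj1g y) (esym (expg1n _ _))).
pose w := aff_word x 1 y : aff 0 -> gT.
have ox : #[x] = 11 by apply: nt_prime_order.
have w_ker g : g \in line -> w g = 1 -> g = 1.
  case: g => i [n z]; rewrite inE /= => /eqP->.
  rewrite /w aff_wordP expg1n mulg1 => wg.
  have i0 : i = 0%R.
    have xx : x ^ (y ^+ i) = x.
      rewrite -[y ^+ i]invgK (mulg1_eq wg).
      by apply/conjg_fixP/commgP/commuteV/commuteX; exact: commute_refl.
    have := @expg_conj gT y x three i x11 xy 1%R; rewrite mulr1 expg1 xx => /eqP.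
    rewrite -{1}[x]expg1 eq_expg_mod_order ox !modn_small //.
    have := @Zp_check 3 (fun i => (three ^+ i == 1)%R ==> (i == 0%R)) isT i.
    by move=> /implyP i0 /eqP t1; apply/eqP/i0/eqP/val_inj.
  move: wg; rewrite i0 mul1g => /eqP; rewrite -order_dvdn ox => n0.
  congr (_, (_, _)); apply/val_inj => /=; case: (posnP n) => // n_gt0.
  by move: n0; rewrite gtnNdvd // (ltn_ord n).
have w_inj : {in line &, injective w}.
  move=> g h gL hL wgh; apply: (mulIg h^-1); rewrite mulgV; apply: w_ker.
    by rewrite groupM ?groupV.
  by apply: (mulIg (w h)); rewrite -wM mulgKV mul1g.
pose f := Morphism (in2W wM : {in line &, {morph w : g h / g * h}}).
have f_inj : 'injm f by apply/injmP.
have fH : f @* line = H.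
  apply/eqP; rewrite eqEcard card_injm //= card_line H55 leqnn andbT.
  apply/subsetP=> _ /morphimP[g _ _ ->] /=.
  by rewrite /w /aff_word expg1n mulg1 groupM ?groupX.
by rewrite isog_sym -fH sub_isog.
Qed.

Lemma expg_natF (gT : groupType) (x : gT) m : x ^+ 11 = 1 -> x ^+ (m%:R : 'F_11)%R = x ^+ m.
Proof. by move=> x11; rewrite -[RHS](expg_modn _ x11) val_Fp_nat. Qed.

(** Take z of order 5 and a power y of z whose image modulo F_11^2 is c. The
subgroup meets F_11^2 in the group generated by x, so x is an eigenvector of y,
with eigenvalue 3 or 3^r. In the second case a further power of y has
eigenvalue 3. *)
Lemma order55_generators r s (H : {group aff r}) : ((three ^+ r) ^+ s = three)%R ->
  #|H| = 55 -> exists x, exists y, [/\ x \in H, y \in H & x != 1] /\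
     [/\ x ^+ 11 = 1, y ^+ 5 = 1 & x ^ y = x ^+ 3].
Proof.
move=> rs H55.
have [||x xH ox] := @Cauchy _ 11 H; rewrite ?H55 //.
have [||z zH oz] := @Cauchy _ 5 H; rewrite ?H55 //.
have x11 : x ^+ 11 = 1 by rewrite -ox expg_order.
have x1 : x != 1 by rewrite -order_eq1 ox.
have z1 : z.1 != 0%R.
  apply/negP=> z0; have : z \in translations r by rewrite inE.
  by move/translationsP/eqP; rewrite -order_dvdn oz.
(* The first coordinate of z is invertible modulo 5. *)
have [n zn] : exists n, (z.1 *+ n = 1)%R.
  have := @Zp_check 3 (fun j => (j != 0%R) ==> has (fun n => j *+ n == 1)%R (iota 0 5)).
  by move=> /(_ isT z.1)/implyP/(_ z1)/hasP[n _ /eqP]; exists n.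
pose y := z ^+ n; have yH : y \in H by rewrite groupX.
have y1 : y.1 = 1%R by rewrite aff_fstX.
have xy_cycle : x ^ y \in <[x]>.
  pose K := (H :&: translations r)%G.
  (* The order of K is a power of 11 dividing 55, so K has order at most 11. *)
  have K11 : 11.-nat #|K| by apply/abelem_pgroup/translations_abelem/subsetIr.
  have KH : #|K| \in divisors 55 by rewrite -dvdn_divisors // -H55 cardSg ?subsetIl.
  have xK : <[x]> \subset K by rewrite cycle_subG inE xH; exact/translationsP.
  have -> : <[x]> = K.
    apply/eqP; rewrite eqEcard xK -orderE ox /=.
    by move: KH K11; rewrite !inE => /or4P[] /eqP->.
  by rewrite inE groupJ //; apply/translationsP; rewrite -conjXg x11 conj1g.
have /cycleP[m xy] := xy_cycle.
(* The eigenvalue m of y on x is 3 or 3^r; some power of it is 3. *)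
have [t mt] : exists t, ((m%:R : 'F_11) ^+ t = three)%R.
  have xE := aff_order11 x11; rewrite xE aff_conj aff_VX y1 in xy.
  have u0 : x.2 != 0%R by apply: contraNneq x1 => u0; rewrite xE u0.
  have tw : twist r 1%R x.2 = (x.2 *+ m)%R := congr1 snd xy.
  have /orP[/eqP e|/eqP e] := @twist_eigen r 1%R x.2 m u0 tw.
    by exists 1%N; rewrite -e !expr1.
  by exists s; rewrite -e -[RHS]rs !expr1.
exists x, (y ^+ t); split; split=> //; first by rewrite groupX.
  by rewrite /y -!expgnA mulnA [(_ * 5)%N]mulnC expgnA -oz expg_order expg1n.
rewrite -(expg_natF m x11) in xy.
by have := @expg_conj _ y x _ t x11 xy 1%R; rewrite mulr1 mt expg1 => ->.
Qed.

(** The orders 1, 5, 11 and 121 leave only cyclic and elementary abelian groups;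
order 55 leaves only the nonabelian group, because an element of order 5 commutes
with no translation but 1. *)
Lemma isog_proper_subgroups r1 r2 s1 s2 (H1 : {group aff r1}) (H2 : {group aff r2}) :
  ((three ^+ r1) ^+ s1 = three)%R -> ((three ^+ r2) ^+ s2 = three)%R ->
  #|H1| = #|H2| -> #|H1| != 605 -> H1 \isog H2.
Proof.
move=> r1s1 r2s2 H12 H605.
have : #|H1| \in divisors 605 by rewrite -dvdn_divisors // -(card_aff r1) -cardsT cardSg ?subsetT.
have -> : divisors 605 = [:: 1; 5; 11; 55; 121; 605]%N by [].
have iso_prime p : prime p -> #|H1| = p -> H1 \isog H2.
  move=> pp H1p; have c1 : cyclic H1 by rewrite prime_cyclic ?H1p.
  have c2 : cyclic H2 by rewrite prime_cyclic -?H12 ?H1p.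
  by rewrite isog_cyclic_card // c2 H12 eqxx.
rewrite !inE (negPf H605) orbF => /or4P[/eqP h|/eqP h|/eqP h|/orP[/eqP h|/eqP h]].
- have c1 : cyclic H1 by rewrite (card1_trivg h) cyclic1.
  have c2 : cyclic H2 by rewrite (card1_trivg (etrans (esym H12) h)) cyclic1.
  by rewrite isog_cyclic_card // c2 H12 eqxx.
- exact: iso_prime h.
- exact: iso_prime h.
- have [x [y [[xH yH x1] [x11 y5 xy]]]] := order55_generators r1s1 h.
  have [x' [y' [[x'H y'H x'1] [x'11 y'5 x'y']]]] := order55_generators r2s2 (etrans (esym H12) h).
  apply: isog_trans (isog_line h xH yH x1 x11 y5 xy) _; rewrite isog_sym.
  exact: isog_line (etrans (esym H12) h) x'H y'H x'1 x'11 y'5 x'y'.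
have abel r (H : {group aff r}) : #|H| = 121 -> 11.-abelem H.
  move=> hH; apply: translations_abelem; apply/subsetP=> g gH.
  have g121 : (g ^+ 121)%g = 1 by rewrite -hH expg_cardG.
  rewrite inE; have := @Zp_check 3 (fun j => (j *+ 121 == 0)%R ==> (j == 0%R)) isT g.1.
  by move=> /implyP; apply; rewrite -aff_fstX g121.
by rewrite (isog_abelem_card _ (abel _ H1 h)) (abel _ H2 (etrans (esym H12) h)) H12 eqxx.
Qed.

Local Close Scope group_scope.
Local Open Scope ring_scope.

(** * The group algebras *)

Local Notation V := ('F_11 * 'F_11)%type.

Definition dot (u v : V) : 'F_11 := u.1 * v.1 + u.2 * v.2.

Lemma dotDl u u' v : dot (u + u') v = dot u v + dot u' v.
Proof. by rewrite /dot /= !mulrDl addrACA. Qed.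
Lemma dotDr u v v' : dot u (v + v') = dot u v + dot u v'.
Proof. by rewrite /dot /= !mulrDr addrACA. Qed.
Lemma dotNl u v : dot (- u) v = - dot u v.
Proof. by rewrite /dot /= !mulNr opprD. Qed.
Lemma dotNr u v : dot u (- v) = - dot u v.
Proof. by rewrite /dot /= !mulrN opprD. Qed.
Lemma dotC u v : dot u v = dot v u.
Proof. by rewrite /dot [u.1 * _]mulrC [u.2 * _]mulrC. Qed.

Lemma dot_twist r j u v : dot u (twist r j v) = dot (twist r j u) v.
Proof. by rewrite /dot /twist /= !mulrA -!(mulrC (_ ^+ j)). Qed.

Lemma sum_aff r (U : nmodType) (F : aff r -> U) :
  \sum_x F x = \sum_(j : 'Z_5) \sum_(z : V) F (j, z).
Proof. by rewrite pair_bigA; apply: eq_bigr => -[]. Qed.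

Section Fourier.
Variables (K : fieldType) (z11 : K).
Hypotheses (z11X : z11 ^+ 11 = 1) (z11N1 : z11 != 1) (K11 : 11%:R != 0 :> K).

(** An additive character of F_11; it is nontrivial since z11 != 1. *)
Definition chi (a : 'F_11) : K := z11 ^+ a.

Lemma chiD a b : chi (a + b) = chi a * chi b.
Proof. by rewrite /chi -exprD -[RHS](expr_mod _ z11X). Qed.

Lemma chi0 : chi 0 = 1. Proof. by []. Qed.

Lemma chi_eq1 a : (chi a == 1) = (a == 0).
Proof.
apply/eqP/eqP => [ca1|->//]; apply/eqP; apply: contraNT z11N1 => a0.
have chiX n : chi (a *+ n) = 1.
  by elim: n => // n IHn; rewrite mulrS chiD IHn ca1 mulr1.
have := chiX (a^-1 : 'F_11); rewrite -mulr_natr natr_Zp divff //.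
by rewrite /chi expr1 => ->.
Qed.

Lemma sum_chi a : \sum_(x : 'F_11) chi (a * x) = if a == 0 then 11%:R else 0.
Proof.
have [->|a0] := eqVneq a 0.
  under eq_bigr do rewrite mul0r chi0.
  by rewrite sumr_const card_ord.
apply/eqP; have ca : chi a - 1 != 0 by rewrite subr_eq0 chi_eq1.
rewrite -(inj_eq (mulfI ca)) mulr0 mulrBl mul1r mulr_sumr subr_eq0; apply/eqP.
rewrite [RHS](reindex_inj (addrI 1)) /=; apply: eq_bigr => x _.
by rewrite mulrDr mulr1 chiD.
Qed.

Lemma sum_chi_dot u : \sum_v chi (dot u v) = if u == 0 then 121%:R else 0.
Proof.
rewrite -(pair_bigA _ (fun x y => chi (dot u (x, y)))) /=.
under eq_bigr => x _ do
  (under eq_bigr => y _ do rewrite /dot chiD /=; rewrite -mulr_sumr).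
rewrite -mulr_suml !sum_chi; case: u => a b /=; rewrite xpair_eqE.
by case: (a == 0); case: (b == 0); rewrite ?(mul0r, mulr0) // -natrM.
Qed.

Lemma n121 : 121%:R != 0 :> K.
Proof. by rewrite (natrM _ 11 11) mulf_neq0. Qed.

Lemma chi_twist r j u v x y :
  chi (- dot u x) * chi (- dot v (- twist r j x + y)) =
  chi (- dot v y) * chi (dot (twist r j v - u) x).
Proof.
rewrite -!chiD dotDl dotNl dotDr dotNr dot_twist; congr chi.
move: (dot u x) (dot (twist r j v) x) (dot v y) => a b c.
by rewrite opprD opprK addrA addrC [- a + b]addrC.
Qed.

Section FourierHom.
Variables (r r' : nat) (psi : V -> V).

(** The Fourier transform on F_11^2, followed by the relabelling psi of the
characters and by the inverse transform, on each coset of F_11^2. *)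
Definition fourier_mx (g : aff r) (h : aff r') : K :=
  if g.1 == h.1 then
    121%:R^-1 * \sum_u chi (dot u g.2) * chi (- dot (psi u) h.2)
  else 0.

Section Spectral.
Variables (A : algType K) (t : aff r' -> A).
Hypothesis tM : forall g h, t g * t h = t (g * h)%g.

(** The Fourier transform of t on the coset c^i F_11^2. For i = 0 these are the
primitive idempotents of the group algebra of F_11^2, and in general they are c^i
times these idempotents. So spectralM says that c permutes the idempotents as it
permutes the characters. *)
Definition spectral (i : 'Z_5) (u : V) : A :=
  121%:R^-1 *: \sum_(z : V) chi (- dot u z) *: t (i, z).

Lemma spectralM i j u v :
  spectral i u * spectral j v =
  if u == twist r' j v then spectral (i + j) v else 0.
Proof.
rewrite /spectral -scalerAl -scalerAr scalerA mulr_suml.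
under eq_bigr => x _.
  rewrite mulr_sumr (reindex_inj (addrI (- twist r' j x))) /=.
  under eq_bigr => y _.
    rewrite -scalerAl -scalerAr scalerA tM affM /= addrA subrr add0r chi_twist.
  over.
over.
rewrite exchange_big /=.
under eq_bigr => y _ do (rewrite -scaler_suml -mulr_sumr sum_chi_dot).
rewrite subr_eq0 eq_sym; case: eqP => _; last first.
  by rewrite big1 ?scaler0 // => y _; rewrite mulr0 scale0r.
under eq_bigr do rewrite mulrC -scalerA.
by rewrite -scaler_sumr scalerA -mulrA mulVf ?mulr1 // n121.
Qed.

Lemma sum_spectral : \sum_u spectral 0 u = t 1%g.
Proof.
rewrite -scaler_sumr exchange_big /= (bigD1 (0 : V)) //=.
rewrite [X in _ + X]big1 ?addr0 => [|z z0].
  rewrite -scaler_suml; under eq_bigr do rewrite -dotNr dotC.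
  by rewrite sum_chi_dot oppr0 eqxx scalerA mulVf ?n121 // scale1r.
rewrite -scaler_suml; under eq_bigr do rewrite -dotNr dotC.
by rewrite sum_chi_dot oppr_eq0 (negPf z0) scale0r.
Qed.

Lemma fourier_mxE g :
  \sum_x fourier_mx g x *: t x = \sum_u chi (dot u g.2) *: spectral g.1 (psi u).
Proof.
case: g => i v /=; rewrite sum_aff.
rewrite (bigD1 i) //= [X in _ + X]big1 ?addr0 => [|j nij]; last first.
  by rewrite big1 // => z _; rewrite /fourier_mx /= eq_sym (negPf nij) scale0r.
under [RHS]eq_bigr => u _ do rewrite /spectral scalerA mulrC -scalerA scaler_sumr.
rewrite -scaler_sumr exchange_big scaler_sumr /=; apply: eq_bigr => z _.
rewrite /fourier_mx /= eqxx -scalerA; congr (_ *: _).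
by rewrite scaler_suml; apply: eq_bigr => u _; rewrite scalerA.
Qed.

End Spectral.

Hypotheses (psi_bij : bijective psi)
  (psi_twist : forall j u, psi (twist r j u) = twist r' j (psi u)).

(** The relations of spectralM only involve the action on the set of characters,
so they are preserved by an equivariant relabelling. *)
Lemma fourier_mx_multiplicative : full_multiplicative fourier_mx.
Proof.
move=> A t tM; split=> [|g h].
  rewrite fourier_mxE /=; under eq_bigr => u _.
    rewrite (_ : dot u 0 = 0) ?chi0 ?scale1r; last by rewrite /dot !mulr0 addr0.
  over.
  rewrite -(sum_spectral t) [RHS](reindex psi) //=; exact: onW_bij.
rewrite !fourier_mxE mulr_sumr; apply: eq_bigr => v _.
rewrite mulr_suml (bigD1 (twist r h.1 v)) //= big1 ?addr0 => [|u nu].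
  rewrite -scalerAl -scalerAr spectralM // psi_twist eqxx scalerA.
  by rewrite dotDr chiD dot_twist.
rewrite -scalerAl -scalerAr spectralM // -psi_twist (inj_eq (bij_inj psi_bij)).
by rewrite (negPf nu) !scaler0.
Qed.
End FourierHom.

Lemma fourier_mx_inv r r' psi psi' : cancel psi psi' ->
  forall g h, \sum_x @fourier_mx r r' psi g x * @fourier_mx r' r psi' x h = (g == h)%:R.
Proof.
move=> psiK [i v] [j y].
rewrite sum_aff.
rewrite (bigD1 i) //= [X in _ + X]big1 ?addr0 => [|k nik]; last first.
  by rewrite big1 // => z _; rewrite /fourier_mx /= eq_sym (negPf nik) mul0r.
rewrite xpair_eqE /fourier_mx /= eqxx; case: (i == j); last first.
  by rewrite big1 // => z _; rewrite mulr0.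
have sum_z u w :
    \sum_z (121%:R^-1 / 121%:R) *
       (chi (dot u v) * chi (- dot (psi u) z) *
        (chi (dot w z) * chi (- dot (psi' w) y))) =
    if w == psi u then 121%:R^-1 * (chi (dot u v) * chi (- dot (psi' w) y)) else 0.
  under eq_bigr => z _ do
    rewrite [chi (dot w z) * _]mulrC [X in _ * X]mulrACA -[chi (- dot (psi u) z) * _]chiD
      -(dotNl (psi u)) -dotDl mulrA.
  rewrite -mulr_sumr sum_chi_dot addrC subr_eq0; case: eqP => _; rewrite ?mulr0 //.
  by rewrite mulrAC -(mulrA _ _ 121%:R) mulVf ?mulr1 // n121.
under eq_bigr => z _ do rewrite mulrACA big_distrlr /= mulr_sumr.
rewrite exchange_big /=.
under eq_bigr => u _.
  under eq_bigr => z _ do rewrite mulr_sumr.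
  rewrite exchange_big /=.
  under eq_bigr => w _ do rewrite sum_z.
  rewrite -big_mkcond big_pred1_eq psiK -dotNr -chiD -dotDr dotC.
over.
rewrite -mulr_sumr sum_chi_dot subr_eq0; case: eqP => _; last exact: mulr0.
by rewrite mulVf // n121.
Qed.

End Fourier.

(** A root of 1 + X + ... + X^10; it is not 1 because 11 is invertible. *)
Lemma exists_root11 (K : closedFieldType) : [pchar K] =i pred0 ->
  exists2 z : K, z ^+ 11 = 1 & z != 1 /\ 11%:R != 0 :> K.
Proof.
move=> K0; have K11 : 11%:R != 0 :> K.
  by rewrite natf_neq0_pchar; apply/pnatP => // p _ _; rewrite inE /= K0.
have [z zE] := @solve_monicpoly K 10 (fun=> -1) isT.
(* The root z was chosen with z^10 = - (1 + z + ... + z^9). *)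
have z0 : \sum_(i < 11) z ^+ i = 0.
  rewrite big_ord_recr /= zE -big_split big1 // => i _.
  by rewrite /= mulN1r subrr.
exists z; first by apply/eqP; rewrite -subr_eq0 subrX1 z0 mulr0.
split=> //; apply: contraNneq K11 => z1; rewrite -z0 z1.
by under eq_bigr do rewrite expr1n; rewrite sumr_const card_ord.
Qed.

Definition psi_pow e (u : V) : V := (u.1, u.2 ^+ e).

Lemma psi_pow_twist r r' e : three ^+ (r * e) = three ^+ r' ->
  forall j u, psi_pow e (twist r j u) = twist r' j (psi_pow e u).
Proof.
move=> re j u; apply: (congr1 (pair _)) => /=.
by rewrite exprMn -re exprM (exprAC (three ^+ r) j).
Qed.

(** The exponent 21 works as y^11 = y in F_11. *)
Lemma psi_powK e e' : (e * e' = 21)%N -> cancel (psi_pow e) (psi_pow e').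
Proof.
move=> ee' [x y]; apply: (congr1 (pair _)) => /=; rewrite -exprM ee'.
have y11 : y ^+ 11 = y by have := expf_card y; rewrite card_Fp.
by rewrite (exprD y 11 10) y11 -exprS.
Qed.

Local Close Scope ring_scope.

(** * The isomorphism *)

Lemma Kpar_aff_iso (K : closedFieldType) : [pchar K]%R =i pred0 ->
  exists f : {lrmorphism Kpar K (aff 2) -> Kpar K (aff 4)}%R, bijective f.
Proof.
move=> K0; have [z z11 [z1 K11]] := exists_root11 K0.
have tw24 : opposite_twists 2 4 by [].
have tw42 : opposite_twists 4 2 by [].
(* The exponents solve 9^7 = 4 and 4^3 = 9 modulo 11, with 7 * 3 = 21. *)
have p24 : (three ^+ (2 * 7) = three ^+ 4)%R by apply/val_inj.
have p42 : (three ^+ (4 * 3) = three ^+ 2)%R by apply/val_inj.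
have K73 : cancel (psi_pow 7) (psi_pow 3) by exact: psi_powK.
have K37 : cancel (psi_pow 3) (psi_pow 7) by exact: psi_powK.
have card24 : #|{: aff 2}| = #|{: aff 4}| by rewrite !card_aff.
(* Both 9 and 4 generate the subgroup of order 5, as 9^3 = 4^4 = 3 modulo 11. *)
have gen2 : ((three ^+ 2) ^+ 3 = three)%R by apply/val_inj.
have gen4 : ((three ^+ 4) ^+ 4 = three)%R by apply/val_inj.
have [|||||Fo [F [Fo' [F' [Ff F'f FK F'K]]]]] := @exists_vertex_functor _ _
  (theta_grp tw24) (theta_grp tw42) card24.
- exact: theta_grpK.
- exact: theta_grpK.
- exact: card_theta_grp.
- exact: theta_grpS.
- move=> H1 H2 H12 nH1; apply: (isog_proper_subgroups gen2 gen4 H12).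
  apply: contraNneq nH1 => H605; apply/eqP/val_inj/eqP.
  by rewrite eqEcard subsetT /= cardsT card_aff H605.
apply: (Kpar_iso Ff F'f FK F'K
  (M := fourier_mx z (psi_pow 7)) (M' := fourier_mx z (psi_pow 3))).
- exact: (fourier_mx_multiplicative z11 z1 K11 (Bijective K73 K37) (psi_pow_twist p24)).
- exact: (fourier_mx_multiplicative z11 z1 K11 (Bijective K37 K73) (psi_pow_twist p42)).
- exact: (fourier_mx_inv z11 z1 K11 4 K73).
- exact: (fourier_mx_inv z11 z1 K11 2 K37).
Qed.

Theorem mainTheorem3 :
  [/\ exists f : 'I_605 -> G1, bijective f,
      exists f : 'I_605 -> G2, bijective f,
      ~ (exists f : {multiplicative G1 -> G2}, bijective f) &
      forall K : closedFieldType, [pchar K]%R =i pred0 ->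
        exists f : {lrmorphism Kpar K G1 -> Kpar K G2}%R, bijective f].
Proof.
have k1 : 9 = (three ^+ 2 : 'F_11)%R by vm_compute.
have k2 : 4 = (three ^+ 4 : 'F_11)%R by vm_compute.
have [f1 f1_bij] := pres_aff_iso k1; have [f2 f2_bij] := pres_aff_iso k2.
have [g1 [f1K g1K]] := multiplicative_inverse f1_bij.
have [g2 [f2K g2K]] := multiplicative_inverse f2_bij.
have enum_aff r : bijective (fun i : 'I_605 => enum_val (cast_ord (esym (card_aff r)) i)).
  apply: bij_comp (enum_val_bij _) _.
  by exists (cast_ord (card_aff r)) => i; apply: val_inj.
split.
- exists (fun i => g1 (enum_val (cast_ord (esym (card_aff 2)) i))).
  by apply: (bij_comp _ (enum_aff 2)); exists f1.
- exists (fun i => g2 (enum_val (cast_ord (esym (card_aff 4)) i))).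
  by apply: (bij_comp _ (enum_aff 4)); exists f2.
- case=> f f_bij; apply: aff_not_iso.
  exists (f2 \o (f \o g1) : {multiplicative aff 2 -> aff 4}).
  by apply: bij_comp f2_bij (bij_comp f_bij _); exists f1.
move=> K K0; have [f f_bij] := Kpar_aff_iso K0.
have [F1 F1_bij] := Kpar_transport K f1_bij.
have [F2 F2_bij] := Kpar_transport K (Bijective g2K f2K).
exists (F2 \o (f \o F1) : {lrmorphism Kpar K G1 -> Kpar K G2}%R).
exact: bij_comp F2_bij (bij_comp f_bij F1_bij).
Qed.
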